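(* Let $1\le k<n$, $m+1=\binom nk$, and let $\mathbf b$ be a Plücker weight vector for $k<n$. For every $i=1,\dots,m$ there is a cofibration (cofibre sequence) $$L'(b_{m-i};\mathbf b^{(m-i)})\longrightarrow X^{i-1}\longrightarrow X^i,$$ i.e. there is a continuous map $L'(b_{m-i};\mathbf b^{(m-i)})\to X^{i-1}$ whose mapping cone is $X^i$, with $X^{i-1}\to X^i$ the inclusion.
   Context: Let $1\le k<n$ and $m+1=\binom nk$. A Schubert symbol for $k<n$ is a sequence $\lambda=(\lambda_1<\dots<\lambda_k)$ of integers in $\{1,\dots,n\}$ (identified with its underlying set). Write $\lambda\preceq\mu$ iff $\lambda_i\le\mu_i$ for all $i$, and fix a total order $\lambda^0<\lambda^1<\dots<\lambda^m$ of all Schubert symbols refining $\preceq$. With $e_1,\dots,e_n$ the standard basis of $\mathbb C^n$ and $e_\lambda=e_{\lambda_1}\wedge\dots\wedge e_{\lambda_k}$, identify $\Lambda^k(\mathbb C^n)$ with $\mathbb C^{m+1}$ by $z=\sum_i z_ie_{\lambda^i}$. Let $Pl(k,n)=\{a_1\wedge\dots\wedge a_k: a_i\in\mathbb C^n\}\setminus\{0\}$. $\mathbf b=(b_0,\dots,b_m)\in(\mathbb Z_{\ge1})^{m+1}$ is a Plücker weight vector if for all $1\le i_1<\dots<i_{k-1}\le n$ and $1\le\ell_0<\dots<\ell_k\le n$ the sum $b_{r_j}+b_{s_j}$ takes the same value for all $j\in\{0,\dots,k\}$ with $\ell_j\notin\{i_1,\dots,i_{k-1}\}$, where $\lambda^{r_j}=\{i_1,\dots,i_{k-1},\ell_j\}$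 and $\lambda^{s_j}=\{\ell_0,\dots,\ell_k\}\setminus\{\ell_j\}$. For such $\mathbf b$, $\mathbb C^*$ acts on $Pl(k,n)$ by $t(z_0,\dots,z_m)=(t^{b_0}z_0,\dots,t^{b_m}z_m)$, and $\mathrm{Gr}_{\mathbf b}(k,n)$ is the orbit space with the quotient topology and quotient map $\pi_{\mathbf b}$. Let $\widetilde E(\lambda^i)=\{z\in Pl(k,n): z_i\ne0,\ z_j=0\text{ for }j<i\}$. The sets $\pi_{\mathbf b}(\widetilde E(\lambda^i))$ partition $\mathrm{Gr}_{\mathbf b}(k,n)$ (they are its $q$-cells). Put $X^{m-i}=\bigsqcup_{j\ge i}\pi_{\mathbf b}(\widetilde E(\lambda^j))$ for $i=0,\dots,m$, so $\{pt\}=X^0\subset X^1\subset\dots\subset X^m=\mathrm{Gr}_{\mathbf b}(k,n)$. Let $I(\lambda^i)$ be the set of Schubert symbols obtained from $\lambda^i$ by replacing some $s\in\lambda^i$ by some $s'\notin\lambda^i$ with $s<s'$. Let $G(b_i)=\{t\in\mathbb C^*:t^{b_i}=1\}$. The lens complex $L'(b_i;\mathbf b^{(i)})$ is the quotient of the unit sphere of $\{z\in\mathbb C^{m+1}: z_j=0\text{ if }\lambda^j\notin I(\lambda^i)\}$ by the action $t\cdot(z_0,\dots,z_m)=(t^{b_0}z_0,\dots,t^{b_m}z_m)$ of $t\in G(b_i)$ (empty if $I(\lambda^i)=\emptyset$). *)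

(* Defs.v *)
From HB Require Import structures.
From Stdlib Require Import Relations.
From mathcomp Require Import all_boot all_order all_algebra generic_quotient.
From mathcomp Require Import complex.
From mathcomp Require Import all_classical all_reals all_analysis.

Set Implicit Arguments.
Unset Strict Implicit.
Unset Printing Implicit Defensive.
Import Order.TTheory GRing.Theory Num.Theory.
Import numFieldNormedType.Exports.
Local Open Scope classical_set_scope.
Local Open Scope ring_scope.
Local Open Scope quotient_scope.

(* Stated as a numClosedFieldType so that the analysis library equips it with
   the topology of the modulus. *)
Definition Cplx (R : realType) : numClosedFieldType := complex R.

(** * Quotient spaces, mapping cones, homeomorphisms *)

Definition gen_equiv (T : Type) (r : T -> T -> Prop) : rel T :=
  fun x y => `[< clos_refl_sym_trans T r x y >].

Lemma gen_equiv_class (T : Type) (r : T -> T -> Prop) :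
  equiv_class_of (gen_equiv r).
Proof.
split=> [x|x y|y x z]; rewrite /gen_equiv.
- by apply/asboolP; exact: rst_refl.
- by apply/asboolP/asboolP => H; exact: rst_sym.
- by move=> /asboolP xy /asboolP yz; apply/asboolP; exact: rst_trans yz.
Qed.

Canonical gen_equiv_equiv (T : Type) (r : T -> T -> Prop) :=
  EquivRelPack (gen_equiv_class r).

Definition quot_space (T : topologicalType) (r : T -> T -> Prop) :
  topologicalType := quotient_topology {eq_quot gen_equiv r}.

Definition quot_proj (T : topologicalType) (r : T -> T -> Prop) :
  T -> quot_space r := \pi_(quotient_topology {eq_quot gen_equiv r}).

Definition homeomorphism (X Y : topologicalType) (h : X -> Y) : Prop :=
  continuous h /\
  exists g : Y -> X, [/\ continuous g, cancel h g & cancel g h].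

(* Y x [0,1] + X, as a sum indexed by bool *)
Definition cone_summand (R : realType) (Y X : topologicalType) (c : bool) :
  topologicalType :=
  if c then ((Y * set_type `[0%R, 1%R : R]%classic)%type : topologicalType)
  else X.

Definition cyl_pt (R : realType) (Y X : topologicalType) (y : Y)
    (s : set_type `[0%R, 1%R : R]) : {c & cone_summand R Y X c} :=
  existT (cone_summand R Y X) true (y, s).
Arguments cyl_pt {R Y} X y s.

Definition base_pt (R : realType) (Y X : topologicalType) (x : X) :
  {c & cone_summand R Y X c} := existT (cone_summand R Y X) false x.

Inductive cone_rel (R : realType) (Y X : topologicalType) (f : Y -> X) :
  {c & cone_summand R Y X c} -> {c & cone_summand R Y X c} -> Prop :=
| cone_glue (y : Y) (s : set_type `[0%R, 1%R : R]) of set_val s = 0 :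
    cone_rel f (cyl_pt X y s) (base_pt R Y (f y))
| cone_tip (y y' : Y) (s s' : set_type `[0%R, 1%R : R])
    of set_val s = 1 & set_val s' = 1 :
    cone_rel f (cyl_pt X y s) (cyl_pt X y' s').

(* For empty Y this is X, without an isolated tip. *)
Definition mapping_cone (R : realType) (Y X : topologicalType) (f : Y -> X) :
  topologicalType := quot_space (@cone_rel R Y X f).

Definition cone_base (R : realType) (Y X : topologicalType) (f : Y -> X)
  (x : X) : mapping_cone R f := quot_proj (@cone_rel R Y X f) (base_pt R Y x).

(** * Schubert symbols *)

(* Entries range over 'I_n = {0, ..., n-1} instead of {1, ..., n}. *)
Definition schubert (k n : nat) : Type :=
  {t : k.-tuple 'I_n | sorted (fun i j : 'I_n => (i < j)%N) t}.

Definition sentry k n (l : schubert k n) (p : 'I_k) : 'I_n := tnth (val l) p.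

Definition sset k n (l : schubert k n) : {set 'I_n} := [set s in val l]%SET.

Definition schubert_le k n (l l' : schubert k n) : Prop :=
  forall p : 'I_k, (sentry l p <= sentry l' p)%N.

(* A total order lam 0 < ... < lam m of all the symbols refining the partial
   one. *)
Definition schubert_order k n m (lam : 'I_m.+1 -> schubert k n) : Prop :=
  bijective lam /\
  forall i j, schubert_le (lam i) (lam j) -> (i <= j)%N.

(* mu belongs to the set I(l) of symbols. *)
Definition raised k n (l mu : schubert k n) : Prop :=
  exists s s' : 'I_n, [/\ s \in sset l, s' \notin sset l, (s < s')%N
    & sset mu = (s' |: (sset l :\ s))%SET].

(** * Decomposable vectors *)

(* The exterior power is modelled as the space of alternating tensors, that is,
   alternating arrays indexed by k-tuples of indices: the wedge of the rows
   a_1, ..., a_k of A is \sum_s (-1)^s a_(s 1) (x) ... (x) a_(s k). *)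
Definition wedge (R : realType) k n (A : 'M[Cplx R]_(k, n)) :
    {ffun k.-tuple 'I_n -> (Cplx R)^o} :=
  [ffun t : k.-tuple 'I_n => \det (\matrix_(p < k, q < k) A p (tnth t q))].

Definition basis_wedge (R : realType) k n (l : schubert k n) :
    {ffun k.-tuple 'I_n -> (Cplx R)^o} :=
  wedge (\matrix_(p < k) (delta_mx 0 (sentry l p) : 'rV[Cplx R]_n)).

Definition Pl (R : realType) k n m (lam : 'I_m.+1 -> schubert k n) :
    set 'rV[Cplx R]_m.+1 :=
  fun z : 'rV[Cplx R]_m.+1 => z != 0 /\ exists A : 'M[Cplx R]_(k, n),
    \sum_(i < m.+1) z 0 i *: basis_wedge R (lam i) = wedge A.
Arguments Pl R {k n m} lam _.

(** * Weighted actions and their orbit spaces *)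

(* Here I is the set {i_1 < ... < i_(k-1)} and L the set {l_0 < ... < l_k}. *)
Definition plucker_weight k n m (lam : 'I_m.+1 -> schubert k n)
    (b : 'I_m.+1 -> nat) : Prop :=
  (forall i, (1 <= b i)%N) /\
  forall I L : {set 'I_n}, #|I| = k.-1 -> #|L| = k.+1 ->
  forall l l' : 'I_n, l \in (L :\: I)%SET -> l' \in (L :\: I)%SET ->
  forall r s r' s' : 'I_m.+1,
    sset (lam r) = (l |: I)%SET -> sset (lam s) = (L :\ l)%SET ->
    sset (lam r') = (l' |: I)%SET -> sset (lam s') = (L :\ l')%SET ->
  (b r + b s = b r' + b s')%N.

Definition wact (R : realType) m (b : 'I_m.+1 -> nat) (t : Cplx R)
  (z : 'rV[Cplx R]_m.+1) : 'rV[Cplx R]_m.+1 := \row_i (t ^+ b i * z 0 i).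

Definition orbit_rel (R : realType) m (b : 'I_m.+1 -> nat)
    (G : set (Cplx R)) (S : set 'rV[Cplx R]_m.+1) (z w : set_type S) : Prop :=
  exists2 t, G t & set_val w = wact b t (set_val z).

Definition Gr (R : realType) k n m (lam : 'I_m.+1 -> schubert k n)
    (b : 'I_m.+1 -> nat) : topologicalType :=
  quot_space (@orbit_rel R m b [set t : Cplx R | t != 0] (Pl R lam)).
Arguments Gr R {k n m} lam b.

Definition Gr_proj (R : realType) k n m (lam : 'I_m.+1 -> schubert k n)
    (b : 'I_m.+1 -> nat) : set_type (Pl R lam) -> Gr R lam b :=
  quot_proj (@orbit_rel R m b [set t : Cplx R | t != 0] (Pl R lam)).
Arguments Gr_proj {R k n m} lam b z : rename.

Definition Etilde (R : realType) k n m (lam : 'I_m.+1 -> schubert k n)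
    (i : 'I_m.+1) : set (set_type (Pl R lam)) :=
  [set z : set_type (Pl R lam) | let v : 'rV[Cplx R]_m.+1 := set_val z in
    v 0 i != 0 /\ forall j : 'I_m.+1, (j < i)%N -> v 0 j = 0].
Arguments Etilde R {k n m} lam i _.

Definition skeleton (R : realType) k n m (lam : 'I_m.+1 -> schubert k n)
    (b : 'I_m.+1 -> nat) (d : nat) : set (Gr R lam b) :=
  \bigcup_(j in [set j : 'I_m.+1 | (m - d <= j)%N])
    (Gr_proj lam b @` Etilde R lam j).
Arguments skeleton R {k n m} lam b d _.

Definition raised_sphere (R : realType) k n m (lam : 'I_m.+1 -> schubert k n)
    (i : 'I_m.+1) : set 'rV[Cplx R]_m.+1 :=
  fun z : 'rV[Cplx R]_m.+1 =>
    (forall j, ~ raised (lam i) (lam j) -> z 0 j = 0) /\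
    \sum_(j < m.+1) `|z 0 j| ^+ 2 = 1.
Arguments raised_sphere R {k n m} lam i _.

Definition lens (R : realType) k n m (lam : 'I_m.+1 -> schubert k n)
    (b : 'I_m.+1 -> nat) (i : 'I_m.+1) : topologicalType :=
  quot_space (@orbit_rel R m b [set t : Cplx R | t != 0 /\ t ^+ b i = 1]
    (raised_sphere R lam i)).
Arguments lens R {k n m} lam b i.

(* Main.v *)
(* Every orbit meets the sup-norm unit sphere of Pl(k,n) in a single circle, so a
   point of the q-cell of lam p is a decomposable unit vector z with z_p > 0, up
   to the finite group G(b_p).  The cell is compactified by explicit frames: for
   y in the closed polydisc of the coordinates raised from lam p, arrange the
   entries of y into a k x n matrix u with free columns outside lam p, and put in
   the pivot columns the upper triangular matrix with diagonal 1 - |u_r| and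
   entries - <u_r, u_s> for r < s.  The frame has rank k on the whole closed
   polydisc (at the boundary as well), its first possible Pluecker coordinate is
   prod_r (1 - |u_r|), which vanishes exactly on the boundary, and its row echelon
   form runs bijectively over the open Schubert cell.  A Pluecker weight has the
   form b_mu = c + sum_(a in mu) w_a, which makes the construction equivariant
   under G(b_p) and preserves decomposability.  Restricting to the boundary gives
   the attaching map, and the induced map from the mapping cone to X^i is a
   continuous bijection from a compact space to a Hausdorff one. *)
From HB Require Import structures.
From Stdlib Require Import Relations.
Require Import Defs.
From mathcomp Require Import all_boot all_order all_fingroup all_algebra generic_quotient.
From mathcomp Require Import complex ring lra.
From mathcomp Require Import all_classical all_reals all_analysis.

Set Implicit Arguments.
Unset Strict Implicit.
Unset Printing Implicit Defensive.
Import Order.TTheory GRing.Theory Num.Theory.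
Import numFieldNormedType.Exports.
Local Open Scope ring_scope.

(** * Schubert symbols *)

(** The obstacle is the boundary. Echelon forms describe only the open cell, and going to infinity
    along a ray [r X] of free entries leaves the minors of top degree, whose limit jumps where the
    rank of [X] drops; so the pivot block has to vary with [u]. Its off-diagonal entries are chosen
    so that adding the Gram matrix of [u] gives a lower triangular matrix with diagonal
    [1 - |u_r| + <u_r, u_r>], which stays positive when [|u_r| = 1]. This one fact yields both the
    rank on the boundary and, inside, the unique solvability of [tri u *m b = u] for a prescribed
    echelon part [b]: rows are found from the last one upwards, and each step reduces to
    [v = (1 - |v|) w], solved by [v = w / (1 + |w|)]. Equivariance holds because norms ignore
    diagonal phases and Hermitian products change by the phases of the pivots. All weights being at
    least 1, a scalar with [|t| <= 1] shrinks the sup norm at least by the factor [|t|]. This makes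
    unit representatives unique up to a circle and leaves only a compact set of scalars to handle in
    the Hausdorff property. *)

Section Symbols.
Variables k n : nat.
Implicit Types (l mu : schubert k n) (S : {set 'I_n}).

Lemma sentry_ltn l (p q : 'I_k) : (sentry l p < sentry l q)%N = (p < q)%N.
Proof.
have lt (p0 q0 : 'I_k) : (p0 < q0)%N -> (sentry l p0 < sentry l q0)%N.
  move=> pq; rewrite /sentry !(tnth_nth (sentry l p0)).
  have tr : transitive (fun i j : 'I_n => (i < j)%N) by move=> ? ? ?; exact: ltn_trans.
  by apply: (sorted_ltn_nth tr _ (valP l)); rewrite // inE size_tuple.
case: (ltngtP p q) => [/lt->//|/lt qp|/val_inj->]; last by rewrite ltnn.
by apply/negbTE; rewrite -leqNgt ltnW.
Qed.

Lemma sentry_leq l (p q : 'I_k) : (sentry l p <= sentry l q)%N = (p <= q)%N.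
Proof. by rewrite leqNgt sentry_ltn -leqNgt. Qed.

Lemma sentry_inj l : injective (sentry l).
Proof.
move=> p q e; apply/val_inj/eqP.
by rewrite eqn_leq -!(sentry_leq l) e !leqnn.
Qed.

Lemma mem_sset l s : (s \in sset l) = (s \in val l).
Proof. by rewrite inE. Qed.

Lemma ssetP l s : reflect (exists p, s = sentry l p) (s \in sset l).
Proof. by rewrite mem_sset; exact: tnthP. Qed.

Lemma sentry_sset l p : sentry l p \in sset l.
Proof. by apply/ssetP; exists p. Qed.

Lemma ssetE l : sset l = [set sentry l p | p : 'I_k]%SET.
Proof.
apply/setP => s; apply/ssetP/imsetP => [[p ->]|[p _ ->]]; first by exists p.
by exists p.
Qed.

Lemma card_sset l : #|sset l| = k.
Proof. by rewrite ssetE card_imset ?card_ord//; exact: sentry_inj. Qed.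

Lemma sset_inj : injective (@sset k n).
Proof.
move=> l mu e; do 2 apply: val_inj; apply: (irr_sorted_eq _ _ (valP l) (valP mu)).
- by move=> ? ? ?; exact: ltn_trans.
- by move=> ?; rewrite ltnn.
- by move=> s; rewrite -!mem_sset e.
Qed.

Lemma sset_surj S : #|S| = k -> exists l, sset l = S.
Proof.
move=> cS; have sz : size (enum S) == k by rewrite -cardE cS.
have so : sorted (fun i j : 'I_n => (i < j)%N) (Tuple sz).
  rewrite /= /(enum _) sorted_filter//; first by move=> ? ? ?; exact: ltn_trans.
  have := iota_ltn_sorted 0 n; rewrite -val_enum_ord sorted_map.
  by rewrite enumT; exact.
exists (exist _ (Tuple sz) so).
by apply/setP => s; rewrite inE /= mem_enum.
Qed.

Lemma sentry_perm l (t : 'I_k -> 'I_n) : injective t ->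
  (forall q, t q \in sset l) ->
  exists s : 'S_k, forall q, t q = sentry l (s q).
Proof.
move=> tI tl.
have /choice[f fE] q : exists p, t q = sentry l p by exact/ssetP.
have fI : injective f by move=> p q /(congr1 (sentry l)); rewrite -!fE => /tI.
by exists (perm fI) => q; rewrite permE.
Qed.

(** Pigeonhole: if [mu] were smaller at [p], the permutation would send all indices [q >= p]
    injectively to indices strictly above [p]. *)
Lemma schubert_le_perm l mu (s : 'S_k) :
  (forall q, (sentry l q <= sentry mu (s q))%N) -> schubert_le l mu.
Proof.
move=> H p; rewrite leqNgt; apply/negP => lt.
have sub : [set s q | q in [set q : 'I_k | (p <= q)%N]%SET]%SET
    \subset [set q : 'I_k | (p < q)%N]%SET.
  apply/fintype.subsetP => _ /imsetP[q + ->]; rewrite !inE => pq.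
  rewrite -(sentry_ltn mu); apply: (leq_trans lt).
  by apply: leq_trans (H q); rewrite sentry_leq.
have := subset_leq_card sub; rewrite card_imset; last exact: perm_inj.
rewrite leqNgt => /negP; apply; apply: proper_card; apply/properP; split.
  by apply/fintype.subsetP => q; rewrite !inE => /ltnW.
by exists p; rewrite !inE ?ltnn.
Qed.

(** A symbol that admits no raising exchange is the top one. If [mu] exceeded it at [p], the entries
    of [mu] from [p] on would all have to be entries of [l] beyond the [p]-th, and there are too few
    of those. *)
Lemma schubert_le_not_raised l mu :
  (forall p c, c \notin sset l -> (c < sentry l p)%N) -> schubert_le mu l.
Proof.
move=> H p; rewrite leqNgt; apply/negP => lt.
have sub : [set sentry mu q | q in [set q : 'I_k | (p <= q)%N]%SET]%SET
    \subset [set sentry l q | q in [set q : 'I_k | (p < q)%N]%SET]%SET.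
  apply/fintype.subsetP => _ /imsetP[q + ->]; rewrite !inE => pq.
  have ltq : (sentry l p < sentry mu q)%N.
    by apply: (leq_trans lt); rewrite sentry_leq.
  have /ssetP[q' e] : sentry mu q \in sset l.
    by apply: contraT => /(H p); rewrite ltnNge (ltnW ltq).
  by rewrite e; apply: imset_f; rewrite inE -(sentry_ltn l) -e.
have := subset_leq_card sub; rewrite !card_imset; try exact: sentry_inj.
rewrite leqNgt => /negP; apply; apply: proper_card; apply/properP; split.
  by apply/fintype.subsetP => q; rewrite !inE => /ltnW.
by exists p; rewrite !inE ?ltnn.
Qed.

(** Left unsorted, so that [c] takes the very column slot of the [r]-th pivot; sorting it into a
    symbol changes minors only by a sign. *)
Definition swap_entry l (r : 'I_k) (c : 'I_n) (q : 'I_k) : 'I_n :=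
  if q == r then c else sentry l q.

Lemma swap_entry_inj l r c : c \notin sset l -> injective (swap_entry l r c).
Proof.
move=> cl p q; rewrite /swap_entry; case: eqP => [->|_]; case: eqP => [->|_]//.
- by move=> e; rewrite e sentry_sset in cl.
- by move=> e; rewrite -e sentry_sset in cl.
- exact: sentry_inj.
Qed.

Lemma swap_sset l r c (mu : schubert k n) : c \notin sset l ->
  sset mu = (c |: (sset l :\ sentry l r))%SET ->
  exists s : 'S_k, forall q, swap_entry l r c q = sentry mu (s q).
Proof.
move=> cl e; apply: sentry_perm; first exact: swap_entry_inj.
move=> q; rewrite e /swap_entry 2!inE; case: (eqVneq q r) => [_|qr]; first by rewrite eqxx.
by rewrite !inE (inj_eq (@sentry_inj l)) qr -mem_sset sentry_sset orbT.
Qed.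

Lemma swap_card l r c : c \notin sset l ->
  #|(c |: (sset l :\ sentry l r))%SET| = k.
Proof.
move=> cl; rewrite cardsU1 !inE -mem_sset (negbTE cl) andbF /= add1n.
by move: (cardsD1 (sentry l r) (sset l)); rewrite sentry_sset card_sset.
Qed.

Lemma swap_le l r c mu : c \notin sset l -> (c < sentry l r)%N ->
  sset mu = (c |: (sset l :\ sentry l r))%SET -> schubert_le mu l.
Proof.
move=> cl cr /(swap_sset cl)[s sE].
apply: (@schubert_le_perm _ _ s^-1%g) => q.
by rewrite -{1}(permKV s q) -sE /swap_entry; case: eqP => // ->; exact: ltnW.
Qed.

Lemma swap_inj l r c r' c' : c \notin sset l -> c' \notin sset l ->
  (c |: (sset l :\ sentry l r) = c' |: (sset l :\ sentry l r'))%SET ->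
  r = r' /\ c = c'.
Proof.
move=> cl cl' /setP e.
have cc : c = c'.
  apply/eqP; have := e c.
  by rewrite !inE -!mem_sset eqxx (negbTE cl) !andbF /= orbF => <-.
rewrite -cc in e; split=> //; have := e (sentry l r).
rewrite !inE -!mem_sset eqxx sentry_sset /= !andbT.
have -> : (sentry l r == c) = false.
  by apply/negbTE/eqP => E; rewrite -E sentry_sset in cl.
by move/esym/negbFE/eqP/sentry_inj.
Qed.

Lemma swap_raised l r c mu : c \notin sset l -> (sentry l r < c)%N ->
  sset mu = (c |: (sset l :\ sentry l r))%SET -> raised l mu.
Proof. by move=> *; exists (sentry l r), c; split => //; exact: sentry_sset. Qed.

Lemma raised_swap l mu : raised l mu -> exists r c,
  [/\ c \notin sset l, (sentry l r < c)%N &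
      sset mu = (c |: (sset l :\ sentry l r))%SET].
Proof. by move=> [s [s' [/ssetP[r ->] s'l lt e]]]; exists r, s'. Qed.

End Symbols.

(** * Minors and decomposable vectors *)

Section Minors.
Variables (F : fieldType) (k n : nat).
Implicit Types (A : 'M[F]_(k, n)) (f : 'I_k -> 'I_n).

Definition minor A f : F := \det (colsub f A).

Lemma eq_minor A f g : f =1 g -> minor A f = minor A g.
Proof. by move=> fg; congr (\det _); apply/matrixP => a q; rewrite !mxE fg. Qed.

Lemma minor_perm A f (s : 'S_k) : minor A (f \o s) = (-1) ^+ s * minor A f.
Proof.
rewrite /minor (_ : colsub _ A = col_perm s (colsub f A)); last first.
  by apply/matrixP => a q; rewrite !mxE.
by rewrite col_permE det_mulmx det_perm odd_permV mulrC.
Qed.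

Lemma minor_perm_eq0 A f g (s : 'S_k) :
  (forall q, f q = g (s q)) -> (minor A f == 0) = (minor A g == 0).
Proof.
by move=> /(@eq_minor A _ (g \o s)) ->; rewrite minor_perm mulf_eq0 signr_eq0.
Qed.

Lemma minor_mulmx (B : 'M[F]_k) A f : minor (B *m A) f = \det B * minor A f.
Proof.
rewrite -det_mulmx; congr (\det _); apply/matrixP => a q.
by rewrite !mxE; apply: eq_bigr => i _; rewrite mxE.
Qed.

Lemma minor_scale (alpha : 'I_k -> F) (beta : 'I_n -> F) A A' f :
  (forall r c, A' r c = alpha r * A r c * beta c) ->
  minor A' f = (\prod_r alpha r) * (\prod_q beta (f q)) * minor A f.
Proof.
move=> AA'; rewrite /minor.
rewrite (_ : colsub f A' = diag_mx (\row_r alpha r) *m colsub f A *m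
    diag_mx (\row_q beta (f q))); last first.
  by rewrite mul_diag_mx mul_mx_diag; apply/matrixP => a q; rewrite !mxE AA'.
rewrite !det_mulmx !det_diag mulrAC; congr (_ * _ * _).
  by apply: eq_bigr => i _; rewrite mxE.
by apply: eq_bigr => i _; rewrite mxE.
Qed.

Lemma det_neq0_perm (M : 'M[F]_k) : \det M != 0 ->
  exists s : 'S_k, forall i, M i (s i) != 0.
Proof.
apply: contra_neqP => H; rewrite /determinant big1// => s _.
apply/eqP; rewrite mulf_eq0 signr_eq0 /=; apply/prodf_eq0.
apply: contrapT => H'; apply: H; exists s => i.
by apply/negP => e; apply: H'; exists i.
Qed.

Lemma minor_noninj A f : ~ injective f -> minor A f = 0.
Proof.
move=> fI; apply: contrapT => /eqP; apply/negP; rewrite negbK.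
have [p [q [e pq]]] : exists p q, f p = f q /\ p != q.
  apply: contrapT => H; apply: fI => p q e; apply: contrapT => /eqP pq.
  by apply: H; exists p, q.
rewrite /minor -det_tr (determinant_alternate pq)// => a.
by rewrite !mxE e.
Qed.

(** Some term of the Leibniz expansion is nonzero, and each of its factors forces one inequality
    between entries matched by the permutation. *)
Lemma minor_neq0_le A (l mu : schubert k n) :
  (forall r (c : 'I_n), (c < sentry l r)%N -> A r c = 0) ->
  minor A (sentry mu) != 0 -> schubert_le l mu.
Proof.
move=> H /det_neq0_perm[s sP]; apply: (@schubert_le_perm _ _ _ _ s) => q.
rewrite leqNgt; apply/negP => lt; have := sP q.
by rewrite mxE H ?eqxx.
Qed.

(** The submatrix is the identity with its [r]-th column replaced. This reads the entries of an
    echelon form off the Plücker coordinates. *)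
Lemma minor_swap A (l : schubert k n) r c :
  (forall a q, A a (sentry l q) = (a == q)%:R) ->
  minor A (swap_entry l r c) = A r c.
Proof.
move=> H; have E a q : q != r -> colsub (swap_entry l r c) A a q = (a == q)%:R.
  by move=> qr; rewrite mxE /swap_entry (negbTE qr) H.
rewrite /minor /determinant (bigD1 1%g)//= [X in _ + X]big1 ?addr0.
  rewrite odd_perm1 expr0 mul1r (bigD1 r)//= perm1 mxE /swap_entry eqxx.
  by rewrite big1 ?mulr1// => a ar; rewrite perm1 E// eqxx.
move=> s s1; apply/eqP; rewrite mulf_eq0 signr_eq0 /=; apply/prodf_eq0.
have [sr|sr] := eqVneq (s r) r; last first.
  by exists r; rewrite ?E// [r == _]eq_sym (negbTE sr).
have [a sa] : exists a, s a != a.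
  apply: contrapT => N; move/eqP: s1; apply; apply/permP => a; rewrite perm1.
  by apply: contrapT => /eqP sa; apply: N; exists a.
exists a => //; rewrite E; first by rewrite [a == _]eq_sym (negbTE sa).
by apply: contra_neq sa => e; apply: (@perm_inj _ s); rewrite -e in sr *; rewrite sr.
Qed.

End Minors.

Section PlMinors.
Variables (R : realType) (k n m : nat) (lam : 'I_m.+1 -> schubert k n).
Hypothesis hlam : schubert_order lam.
Local Notation C := (Cplx R).
Implicit Types (l mu : schubert k n) (t : k.-tuple 'I_n).

Lemma lam_inj : injective lam.
Proof. by case: hlam => [[g gK _] _]; exact: can_inj gK. Qed.

Lemma lam_surj l : exists i, lam i = l.
Proof. by case: hlam => [[g _ gK] _]; exists (g l). Qed.

Lemma lam_le i j : schubert_le (lam i) (lam j) -> (i <= j)%N.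
Proof. by case: hlam => _; apply. Qed.

Lemma sset_lam_inj i j : sset (lam i) = sset (lam j) -> i = j.
Proof. by move=> /sset_inj/lam_inj. Qed.

Lemma sset_lam_surj (S : {set 'I_n}) : #|S| = k -> exists i, sset (lam i) = S.
Proof. by move=> /sset_surj[l <-]; have [i <-] := lam_surj l; exists i. Qed.

Lemma wedgeE (A : 'M[C]_(k, n)) t : wedge A t = minor A (tnth t).
Proof. by rewrite ffunE. Qed.

Lemma basis_wedgeE l t : basis_wedge R l t =
  \det (\matrix_(p < k, q < k) ((sentry l p == tnth t q)%:R : C)).
Proof.
rewrite ffunE; congr (\det _); apply/matrixP => p q.
by rewrite !mxE eqxx eq_sym.
Qed.

Lemma basis_wedge_neq0 (l mu : schubert k n) t (s : 'S_k) :
  (forall q, tnth t q = sentry mu (s q)) -> basis_wedge R l t != 0 -> l = mu.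
Proof.
move=> tmu; rewrite basis_wedgeE => /det_neq0_perm[s' H].
apply: sset_inj; apply/eqP; rewrite eqEcard !card_sset leqnn andbT.
apply/fintype.subsetP => _ /ssetP[p ->]; have := H p; rewrite mxE.
have [-> _|] := eqVneq (sentry l p) (tnth t (s' p)); last by rewrite eqxx.
by rewrite tmu sentry_sset.
Qed.

Lemma basis_wedge_id (l : schubert k n) : basis_wedge R l (val l) = 1.
Proof.
rewrite basis_wedgeE (_ : (\matrix_(_, _) _) = 1%:M) ?det1//.
by apply/matrixP => p q; rewrite !mxE -/(sentry l q) (inj_eq (@sentry_inj _ _ _)).
Qed.

Lemma sum_basis_wedge (z : 'rV[C]_m.+1) t i (s : 'S_k) :
  (forall q, tnth t q = sentry (lam i) (s q)) ->
  (\sum_(j < m.+1) z 0 j *: basis_wedge R (lam j)) t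
    = z 0 i * basis_wedge R (lam i) t.
Proof.
move=> ti; rewrite sum_ffunE (bigD1 i)//= big1 ?addr0 ?ffunE// => j ji.
rewrite ffunE; have [->|/(basis_wedge_neq0 ti)/lam_inj e] :=
  eqVneq (basis_wedge R (lam j) t) 0; first by rewrite scaler0.
by rewrite e eqxx in ji.
Qed.

(** Leaves the tensor model for good. Both sides of the defining equation alternate in the index
    tuple, so they agree as soon as they agree on sorted tuples: a tuple with a repetition gives
    zero, any other is a permutation of exactly one symbol. *)
Lemma PlP (z : 'rV[C]_m.+1) : Pl R lam z <->
  z != 0 /\ exists A : 'M[C]_(k, n), forall i, z 0 i = minor A (sentry (lam i)).
Proof.
split=> -[z0 [A H]]; split=> //; exists A.
  move=> i; have /= := congr1 (fun f : {ffun _ -> _} => f (val (lam i))) H.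
  rewrite (@sum_basis_wedge _ _ i 1%g) => [|q]; last by rewrite perm1.
  by rewrite basis_wedge_id mulr1 wedgeE.
apply/ffunP => t; rewrite wedgeE.
have [tI|tI] := pselect (injective (tnth t)); last first.
  rewrite minor_noninj// sum_ffunE big1// => i _.
  by rewrite ffunE [X in _ *: X]wedgeE minor_noninj ?scaler0.
have [i iE] : exists i, sset (lam i) = [set tnth t q | q : 'I_k]%SET.
  by apply: sset_lam_surj; rewrite card_imset ?card_ord.
have [s sE] : exists s : 'S_k, forall q, tnth t q = sentry (lam i) (s q).
  by apply: sentry_perm => // q; rewrite iE; apply: imset_f.
rewrite (sum_basis_wedge _ sE) [X in _ * X]wedgeE.
rewrite !(eq_minor _ sE) !(minor_perm _ (sentry (lam i))) -H mulrCA.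
have := basis_wedge_id (lam i); rewrite /basis_wedge wedgeE => ->.
by rewrite mulr1.
Qed.

End PlMinors.

(** * Weights *)

Lemma big_sset (T : Type) (idx : T) (op : Monoid.com_law idx) k n
    (l : schubert k n) (F : 'I_n -> T) :
  \big[op/idx]_(a in sset l) F a = \big[op/idx]_(q < k) F (sentry l q).
Proof. by rewrite ssetE big_imset//=; apply: in2W; exact: sentry_inj. Qed.

Section Weights.
Variables (k n m : nat) (lam : 'I_m.+1 -> schubert k n).
Hypotheses (k0 : (0 < k)%N) (kn : (k < n)%N).
Hypothesis hlam : schubert_order lam.
Variable b : 'I_m.+1 -> nat.
Hypothesis hb : plucker_weight lam b.

Lemma plucker_weight_exchange (beta : {set 'I_n} -> int) :
  (forall i, beta (sset (lam i)) = b i) ->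
  forall I L : {set 'I_n}, #|I| = k.-1 -> #|L| = k.+1 ->
  forall l l' : 'I_n, l \in (L :\: I)%SET -> l' \in (L :\: I)%SET ->
  beta (l |: I)%SET + beta (L :\ l)%SET = beta (l' |: I)%SET + beta (L :\ l')%SET.
Proof.
move=> bE I L cI cL l l' lLI l'LI.
have cU x : x \in (L :\: I)%SET -> #|(x |: I)%SET| = k.
  by rewrite inE => /andP[xI _]; rewrite cardsU1 xI cI add1n prednK.
have cD x : x \in (L :\: I)%SET -> #|(L :\ x)%SET| = k.
  rewrite inE => /andP[_ xL]; have := cardsD1 x L.
  by rewrite xL cL add1n => -[].
have [r rE] := sset_lam_surj hlam (cU _ lLI).
have [s sE] := sset_lam_surj hlam (cD _ lLI).
have [r' r'E] := sset_lam_surj hlam (cU _ l'LI).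
have [s' s'E] := sset_lam_surj hlam (cD _ l'LI).
rewrite -rE -sE -r'E -s'E !bE -!PoszD.
by rewrite (hb.2 _ _ cI cL _ _ lLI l'LI r s r' s').
Qed.

(* The values on the base symbol and on its one-element exchanges determine
   [w] and, by the exchange property, all the weights. *)
Lemma plucker_weight_sum : exists (w : 'I_n -> int) (c : int),
  forall i, (b i)%:Z = c + \sum_(a in sset (lam i)) w a.
Proof.
pose beta S : int := b (odflt ord0 [pick i | sset (lam i) == S]).
have bE i : beta (sset (lam i)) = b i.
  rewrite /beta; case: pickP => [j /eqP/(sset_lam_inj hlam)->//|/(_ i)].
  by rewrite eqxx.
have exch := plucker_weight_exchange bE.
have [l cl] : exists l : {set 'I_n}, #|l| = k.
  by exists (sset (lam ord0)); exact: card_sset.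
have [a0 a0l] : exists a, a \in l by apply/set0Pn; rewrite -card_gt0 cl.
have [c0 c0l] : exists c, c \notin l.
  apply: contrapT => H; have : (k < #|l|)%N.
    rewrite (_ : l = [set: 'I_n]%SET) ?cardsT ?card_ord//.
    by apply/setP => c; rewrite finset.in_setT; apply: contraT => cl'; case: H; exists c.
  by rewrite cl ltnn.
have lne a c : a \in l -> c \notin l -> a != c.
  by move=> al; apply: contraNneq => <-.
(* Normalized by [w a0 = 0]; the exchange formula below then holds by definition when [a = a0] or
   [c = c0]. The other exchanges follow from the relation with [I = l :\ a] and [L] made of [c],
   [c0] and [l :\ a0]. *)
pose w a := if a \in l then beta (c0 |: (l :\ a0))%SET - beta (c0 |: (l :\ a))%SET
            else beta (a |: (l :\ a0))%SET - beta l.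
have swap a c : a \in l -> c \notin l ->
    beta (c |: (l :\ a))%SET = beta l + w c - w a.
  move=> al cl'; rewrite /w al (negbTE cl') [beta l + _]addrC subrK.
  have [->|cc0] := eqVneq c c0; first by rewrite opprB addrC subrK.
  have ca1 : (#|l :\ a0|)%N = k.-1 by have := cardsD1 a0 l; rewrite a0l cl => ->.
  have ca2 : (#|l :\ a|)%N = k.-1 by have := cardsD1 a l; rewrite al cl => ->.
  have cL : #|(c |: (c0 |: (l :\ a0)))%SET| = k.+1.
    rewrite !cardsU1 !inE (negbTE cc0) (negbTE cl') (negbTE c0l) !andbF ca1.
    by rewrite !add1n prednK.
  have := exch _ _ ca2 cL c c0; rewrite !inE !eqxx (negbTE cl') (negbTE c0l) !andbF !orbT.
  have -> : ((c |: (c0 |: (l :\ a0))) :\ c = c0 |: (l :\ a0))%SET.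
    by rewrite setU1K// !inE (negbTE cc0) (negbTE cl') andbF.
  have -> : ((c |: (c0 |: (l :\ a0))) :\ c0 = c |: (l :\ a0))%SET.
    rewrite finset.setUCA setU1K// !inE [c0 == c]eq_sym (negbTE cc0) (negbTE c0l).
    by rewrite andbF.
  by move=> /(_ isT isT); lra.
(* With [c] in [S] outside [l] and [a] in [l] outside [S], the relation for [I = l :\ a] and
   [L = a |: S] compares [S] with the set obtained by trading [c] for [a], which is one step closer
   to [l]. *)
have key N S : (#|S :\: l| <= N)%N -> #|S| = k ->
    beta S = beta l + \sum_(a in S) w a - \sum_(a in l) w a.
  elim: N S => [|N IH] S SN cS.
    have -> : S = l; last by rewrite addrK.
    apply/eqP; rewrite eqEcard cl cS leqnn andbT.
    by rewrite -finset.setD_eq0 -cards_eq0 -leqn0.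
  have [Sl|[c]] := set_0Vmem (S :\: l)%SET; first by apply: IH; rewrite // Sl cards0.
  rewrite inE => /andP[cl' cS'].
  have [a] : exists a, a \in (l :\: S)%SET.
    apply/set0Pn; rewrite -card_gt0; apply: contraTltn cS' => H.
    have lS : l \subset S by rewrite -finset.setD_eq0 -cards_eq0 -leqn0.
    have /eqP <- : l == S by rewrite eqEcard lS cl cS leqnn.
    by [].
  rewrite inE => /andP[aS al].
  have ac := lne _ _ al cl'.
  have ca : (#|l :\ a|)%N = k.-1 by have := cardsD1 a l; rewrite al cl => ->.
  have cL : #|(a |: S)%SET| = k.+1 by rewrite cardsU1 aS cS.
  have := exch _ _ ca cL a c; rewrite !inE !eqxx (negbTE cl') (negbTE aS) cS' !andbF !orbT.
  move=> /(_ isT isT); rewrite finset.setD1K// setU1K// swap//.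
  have -> : ((a |: S) :\ c = a |: (S :\ c))%SET.
    by apply/setP => x; rewrite !inE; case: (eqVneq x a) => [->|]; rewrite ?ac.
  have cS1 := cardsD1 c S; rewrite cS' cS in cS1.
  rewrite (IH (a |: (S :\ c))%SET); first last.
  - by rewrite cardsU1 !inE (negbTE aS) andbF; rewrite -cS1.
  - have sub : ((a |: (S :\ c)) :\: l \subset (S :\: l) :\ c)%SET.
      apply/fintype.subsetP => x; rewrite !inE => /andP[xl /orP[/eqP xa|/andP[-> ->]]]//.
        by rewrite xa al in xl.
      by rewrite xl.
    apply: (leq_trans (subset_leq_card sub)).
    by have := cardsD1 c (S :\: l)%SET; rewrite inE cl' cS' add1n => e; rewrite e in SN.
  rewrite big_setU1 ?inE ?(negbTE aS) ?andbF//= (big_setD1 c cS')/=.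
  lra.
exists w, (beta l - \sum_(a in l) w a) => i.
by rewrite -bE (key _ _ (leqnn _)) ?card_sset// addrAC.
Qed.

End Weights.

(** * The triangular pivot block *)

Section Frames.
Variables (C : numClosedFieldType) (k n : nat).
Implicit Types (u b : 'M[C]_(k, n)) (r s : 'I_k).

Definition gram u : 'M[C]_k := u *m (map_mx Num.conj u)^T.

(* The norm of a row is the sup norm, which makes the closed cell a polydisc;
   the rank argument only needs [1 - |u_r| + <u_r, u_r> > 0]. *)
Definition tri u : 'M[C]_k := \matrix_(r, s)
  if r == s then 1 - `|row r u| else if (r < s)%N then - gram u r s else 0.

Lemma gramE u r s : gram u r s = \sum_c u r c * (u s c)^*.
Proof. by rewrite mxE; apply: eq_bigr => c _; rewrite !mxE. Qed.

Lemma gram_ge0 u r : 0 <= gram u r r.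
Proof. by rewrite gramE; apply: sumr_ge0 => c _; rewrite mul_conjC_ge0. Qed.

Lemma det_tri u : \det (tri u) = \prod_r (1 - `|row r u|).
Proof.
rewrite -det_tr det_trig; last first.
  by apply/is_trig_mxP => i j ij; rewrite !mxE -val_eqE gtn_eqF// ltnNge (ltnW ij).
by apply: eq_bigr => i _; rewrite !mxE eqxx.
Qed.

Lemma tri_unit u : (forall r, `|row r u| < 1) -> tri u \in unitmx.
Proof.
move=> u1; rewrite unitmxE unitfE det_tri; apply/prodf_neq0 => r _.
by rewrite gt_eqF// subr_gt0.
Qed.

(* Woodbury's identity: with [S = tri u + u u^*], which is lower triangular,
   the inverse of [1 + u^* b] is [1 - u^* S^-1 u]. *)
Lemma tri_adj_unit u b : (forall r, `|row r u| < 1) -> tri u *m b = u ->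
  1%:M + (map_mx Num.conj u)^T *m b \in unitmx.
Proof.
move=> u1 ub; set v := (map_mx _ _)^T.
pose S := tri u + gram u.
have SU : S \in unitmx.
  rewrite unitmxE unitfE det_trig; last first.
    apply/is_trig_mxP => i j ij.
    by rewrite mxE [tri _ _ _]mxE -val_eqE ltn_eqF// ij addNr.
  apply/prodf_neq0 => r _; rewrite gt_eqF// mxE [tri _ _ _]mxE eqxx.
  by rewrite ltr_wpDr ?gram_ge0// subr_gt0.
have TS : tri u *m (1%:M + b *m v) = S.
  by rewrite mulmxDr mulmx1 mulmxA ub.
have H : (1%:M + v *m b) *m (1%:M - v *m (invmx S *m u)) = 1%:M.
  rewrite mulmxBr mulmx1 !mulmxA [X in _ - X *m _ *m _](_ : _ = v *m (1%:M + b *m v)).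
    rewrite -[v *m _ *m _]mulmxA -[v *m _ *m _]mulmxA.
    suff -> : (1%:M + b *m v) *m invmx S *m u = b by rewrite addrK.
    rewrite -[b in RHS](mulKmx (tri_unit u1)) ub; congr (_ *m _).
    by rewrite -[1%:M + _](mulKmx (tri_unit u1)) TS -mulmxA mulmxV// mulmx1.
  by rewrite mulmxDl mulmxDr mul1mx mulmx1 mulmxA.
by have [] := mulmx1_unit H.
Qed.

(** Rows are zeroed rather than dropped: the truncations of a partial solution then solve the full
    system of the same size, so that [tri_adj_unit] applies to them. *)
Definition below r u : 'M[C]_(k, n) :=
  \matrix_(s, c) if (r < s)%N then u s c else 0.

Definition lower_op r u b : 'M[C]_n :=
  1%:M + (map_mx Num.conj (below r u))^T *m below r b.

(** Row [r] of [tri u *m b = u] with the Hermitian terms moved to the other side. The operator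
    involves only rows after [r], so [row r u] is the single unknown. *)
Definition row_eq b u r :=
  row r u *m lower_op r u b = (1 - `|row r u|) *: row r b.

Lemma eq_below r u u' : (forall s : 'I_k, (r < s)%N -> row s u = row s u') ->
  below r u = below r u'.
Proof.
move=> H; apply/matrixP => s c; rewrite !mxE; case: ifP => // /H /rowP /(_ c).
by rewrite !mxE.
Qed.

Lemma row_below r s u : row s (below r u) = if (r < s)%N then row s u else 0.
Proof. by apply/rowP => c; rewrite !mxE; case: ifP; rewrite !mxE. Qed.

Lemma row_eqE b u r : row_eq b u r <-> row r (tri u *m b) = row r u.
Proof.
have E : row r (tri u *m b) = (1 - `|row r u|) *: row r b -
    row r u *m (map_mx Num.conj (below r u))^T *m below r b.
  apply/rowP => c; rewrite !mxE (bigD1 r)//= !mxE eqxx; congr (_ + _).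
  rewrite [in RHS](bigD1 r)//= [below r b r c]mxE ltnn mulr0 add0r -sumrN.
  apply: eq_bigr => s sr; rewrite !mxE [r == s]eq_sym (negbTE sr).
  case: ifP => rs; last by rewrite mulr0 oppr0 mul0r.
  rewrite mulNr; congr (- (_ * _)); apply: eq_bigr => d _.
  by rewrite !mxE rs.
rewrite E /row_eq /lower_op mulmxDr mulmx1 mulmxA; split=> [<-|/eqP]; first by rewrite addrK.
by rewrite subr_eq => /eqP ->.
Qed.

Lemma tri_row_eq b u : tri u *m b = u <-> forall r, row_eq b u r.
Proof.
split=> [H r|H]; first by apply/row_eqE; rewrite H.
by apply/row_matrixP => r; apply/row_eqE/H.
Qed.

(** The rows after [r] already solve their equations, hence the truncations satisfy the hypotheses
    of [tri_adj_unit]. *)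
Lemma lower_op_unit r u b :
  (forall s : 'I_k, (r < s)%N -> row_eq b u s /\ `|row s u| < 1) ->
  lower_op r u b \in unitmx.
Proof.
move=> H; apply: tri_adj_unit => [s|].
  by rewrite row_below; case: ifP => [/H[]//|_]; rewrite normr0.
apply/tri_row_eq => s; rewrite /row_eq !row_below; case: ifP => rs; last first.
  by rewrite mul0mx scaler0.
have B v : below s (below r v) = below s v.
  apply/matrixP => a c; rewrite !mxE; case: ifP => // sa.
  by rewrite (ltn_trans rs sa).
by rewrite /lower_op !B; have [] := H s rs.
Qed.

(** Taking norms turns the fixed-point equation into [|v| = (1 - |v|) |w|], whence
    [1 - |v| = 1 / (1 + |w|)]; this is the usual contraction of the whole space onto the open unit
    ball. *)
Lemma scaled_row_exists (w : 'rV[C]_n) :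
  exists2 v : 'rV[C]_n, v = (1 - `|v|) *: w & `|v| < 1.
Proof.
have w1 : 0 < 1 + `|w| by rewrite ltr_pwDl.
exists ((1 + `|w|)^-1 *: w); rewrite normrZ gtr0_norm ?invr_gt0//; last first.
  by rewrite mulrC ltr_pdivrMr// mul1r ltrDr.
congr (_ *: w); rewrite -[X in X - _](mulVf (lt0r_neq0 w1)) -mulrBr addrK.
by rewrite mulr1.
Qed.

Lemma scaled_row_unique (w v v' : 'rV[C]_n) :
  `|v| < 1 -> v = (1 - `|v|) *: w -> `|v'| < 1 -> v' = (1 - `|v'|) *: w -> v = v'.
Proof.
have w1 : 0 < 1 + `|w| by rewrite ltr_pwDl.
have H x : `|x| < 1 -> x = (1 - `|x|) *: w -> x = (1 + `|w|)^-1 *: w.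
  move=> x1 xE; have := congr1 (fun y => `|y|) xE.
  rewrite /= normrZ gtr0_norm ?subr_gt0// => nE.
  rewrite {1}xE; congr (_ *: w); apply: (mulIf (lt0r_neq0 w1)).
  by rewrite mulVf ?lt0r_neq0// mulrDr mulr1 -nE subrK.
by move=> v1 vE v1' vE'; rewrite (H v)// (H v').
Qed.

Lemma row_eq_solve r u b : lower_op r u b \in unitmx ->
  row_eq b u r <-> row r u = (1 - `|row r u|) *: (row r b *m invmx (lower_op r u b)).
Proof.
move=> LU; rewrite /row_eq; split=> [H|H].
  by rewrite scalemxAl -H mulmxK.
by rewrite {1}H -scalemxAl mulmxKV.
Qed.

Lemma tri_exists b : exists2 u, tri u *m b = u & forall r, `|row r u| < 1.
Proof.
(* [j] counts the rows solved so far, from the bottom. Changing row [k - j - 1] affects no equation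
   of a later row, because those look only further down. *)
have H j : exists u, forall r : 'I_k, (k - j <= r)%N ->
    row_eq b u r /\ `|row r u| < 1.
  elim: j => [|j [u IH]].
    by exists 0 => r; rewrite subn0 leqNgt ltn_ord.
  have [kj|jk] := leqP k j.
    exists u => r _; apply: IH; rewrite (eqP kj); exact: leq0n.
  have jr0 : (k - j.+1 < k)%N by rewrite ltn_subrL (leq_trans _ jk).
  pose r0 := Ordinal jr0.
  have r0s (s : 'I_k) : (r0 < s)%N -> (k - j <= s)%N by rewrite -(subnSK jk).
  have [v vE v1] := scaled_row_exists (row r0 b *m invmx (lower_op r0 u b)).
  pose u1 : 'M[C]_(k, n) := \matrix_(s, c) if s == r0 then v 0 c else u s c.
  have rowu1 s : row s u1 = if s == r0 then v else row s u.
    by apply/rowP => c; rewrite !mxE; case: eqP; rewrite ?mxE.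
  have Bu1 (s : 'I_k) : (r0 <= s)%N -> below s u1 = below s u.
    move=> r0s'; apply: eq_below => a sa; rewrite rowu1.
    by case: eqP => // e; move: (leq_ltn_trans r0s' sa); rewrite e ltnn.
  exists u1 => r; rewrite leq_eqVlt => /orP[/eqP e|lt].
    have -> : r = r0 by apply/val_inj.
    have Lu : lower_op r0 u1 b = lower_op r0 u b by rewrite /lower_op Bu1.
    rewrite rowu1 eqxx; split=> //; apply/row_eq_solve; last by rewrite rowu1 eqxx Lu.
    by rewrite Lu; apply: lower_op_unit => s /r0s/IH.
  have [e1 e2] := IH _ (r0s _ lt); have rr0 : r == r0 = false by rewrite -val_eqE gtn_eqF.
  by rewrite /row_eq /lower_op rowu1 rr0 Bu1// ltnW.
have [u Hu] := H k; exists u => [|r]; last by apply Hu; rewrite subnn.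
by apply/tri_row_eq => r; apply Hu; rewrite subnn.
Qed.

Lemma tri_unique b u u' :
  tri u *m b = u -> (forall r, `|row r u| < 1) ->
  tri u' *m b = u' -> (forall r, `|row r u'| < 1) -> u = u'.
Proof.
move=> /tri_row_eq uE u1 /tri_row_eq uE' u1'.
have H j (r : 'I_k) : (k - j <= r)%N -> row r u = row r u'.
  elim: j r => [|j IH] r; first by rewrite subn0 leqNgt ltn_ord.
  move=> jr; have Luu : lower_op r u b = lower_op r u' b.
    rewrite /lower_op (@eq_below r u u')// => s rs; apply: IH.
    by have := leq_ltn_trans jr rs; rewrite subnS; case: (k - j)%N.
  have LU : lower_op r u b \in unitmx by exact: lower_op_unit.
  have /(row_eq_solve LU) e := uE r.
  have := uE' r; rewrite row_eq_solve -?Luu// => e'.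
  exact: (scaled_row_unique (u1 r) e (u1' r) e').
by apply/row_matrixP => r; apply: (H k); rewrite subnn.
Qed.

End Frames.

(** * Frames *)

Section MatrixNorm.
Variables (K : numFieldType) (p q : nat).
Implicit Types x y : 'M[K]_(p, q).

Lemma le_entry_mx_norm x i j : `|x i j| <= `|x|.
Proof.
rewrite [leRHS]/Num.Def.normr /= mx_normE -[leLHS]nngE num_le.
exact: (le_bigmax _ (fun i : 'I_p * 'I_q => (`|x i.1 i.2|)%:nng) (i, j)).
Qed.

Lemma mx_norm_attained x : x != 0 -> exists i j, `|x| = `|x i j|.
Proof. by rewrite -normr_eq0 => /mx_norm_neq0[[i j] /= e]; exists i, j. Qed.

Lemma mx_norm_le x e : 0 <= e -> (forall i j, `|x i j| <= e) -> `|x| <= e.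
Proof.
move=> e0 H; have [->|/mx_norm_attained[i [j ->]]//] := eqVneq x 0.
by rewrite normr0.
Qed.

Lemma mx_norm_lt x e : 0 < e -> (forall i j, `|x i j| < e) -> `|x| < e.
Proof.
move=> e0 H; have [->|/mx_norm_attained[i [j ->]]//] := eqVneq x 0.
by rewrite normr0.
Qed.

Lemma eq_mx_norm x y : (forall i j, `|x i j| = `|y i j|) -> `|x| = `|y|.
Proof.
move=> H; apply/le_anti/andP; split; apply: mx_norm_le => // i j.
  by rewrite H le_entry_mx_norm.
by rewrite -H le_entry_mx_norm.
Qed.

End MatrixNorm.

Section CellFrames.
Variables (C : numClosedFieldType) (k n : nat) (l : schubert k n).
Implicit Types (u b A : 'M[C]_(k, n)) (r s : 'I_k) (c : 'I_n).

(** These positions are the raising exchanges, hence correspond one to one to the coordinates of the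
    closed disc. *)
Definition free_pos r (c : 'I_n) := (c \notin sset l) && (sentry l r < c)%N.

Definition cell_supp u := forall r c, ~~ free_pos r c -> u r c = 0.

Definition emx : 'M[C]_(k, n) := \matrix_(r, c) (c == sentry l r)%:R.

Definition frame u : 'M[C]_(k, n) := tri u *m emx + u.

Lemma emx_sentry r q : emx r (sentry l q) = (r == q)%:R.
Proof. by rewrite mxE (inj_eq (@sentry_inj _ _ l)) eq_sym. Qed.

Lemma emx_out r c : c \notin sset l -> emx r c = 0.
Proof.
by rewrite mxE; case: eqP => // ->; rewrite sentry_sset.
Qed.

Lemma mul_emx_sentry (T : 'M[C]_k) r q : (T *m emx) r (sentry l q) = T r q.
Proof.
rewrite mxE (bigD1 q)//= emx_sentry eqxx mulr1 big1 ?addr0// => s sq.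
by rewrite emx_sentry (negbTE sq) mulr0.
Qed.

Lemma mul_emx_out (T : 'M[C]_k) r c : c \notin sset l -> (T *m emx) r c = 0.
Proof. by move=> cl; rewrite mxE big1// => s _; rewrite emx_out ?mulr0. Qed.

Lemma cell_supp_sentry u r q : cell_supp u -> u r (sentry l q) = 0.
Proof. by apply; rewrite /free_pos sentry_sset. Qed.

Lemma frame_sentry u r q : cell_supp u -> frame u r (sentry l q) = tri u r q.
Proof. by move=> us; rewrite mxE mul_emx_sentry cell_supp_sentry ?addr0. Qed.

Lemma frame_out u r c : c \notin sset l -> frame u r c = u r c.
Proof. by move=> cl; rewrite mxE mul_emx_out ?add0r. Qed.

Lemma frame_lt u r c : cell_supp u -> (c < sentry l r)%N -> frame u r c = 0.
Proof.
move=> us cr; have [/ssetP[q cq]|cl] := boolP (c \in sset l); last first.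
  by rewrite frame_out// us// /free_pos negb_and -leqNgt (ltnW cr) orbT.
rewrite cq frame_sentry// mxE -val_eqE.
by move: cr; rewrite cq sentry_ltn => qr; rewrite gtn_eqF// ltnNge ltnW.
Qed.

Lemma frame_minor u : cell_supp u ->
  minor (frame u) (sentry l) = \prod_r (1 - `|row r u|).
Proof.
move=> us; rewrite -det_tri; congr (\det _).
by apply/matrixP => r q; rewrite mxE frame_sentry.
Qed.

Lemma frame_minor_le u mu : cell_supp u ->
  minor (frame u) (sentry mu) != 0 -> schubert_le l mu.
Proof. by move=> us; apply: minor_neq0_le => r c; exact: frame_lt. Qed.

(** Where the first term dies, at norm one, the row is nonzero and the Hermitian square takes
    over. *)
Lemma row_norm_gram u r : `|row r u| <= 1 -> 0 < 1 - `|row r u| + gram u r r.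
Proof.
move=> u1; have [e|ne] := eqVneq `|row r u| 1; last first.
  by rewrite ltr_wpDr ?gram_ge0// subr_gt0 lt_neqAle ne.
rewrite e subrr add0r lt_def gram_ge0 andbT; apply/eqP => g0.
suff : row r u = 0 by move=> r0; move: e; rewrite r0 normr0 => /eqP; rewrite eq_sym oner_eq0.
apply/rowP => c; rewrite !mxE; move: g0; rewrite gramE => /psumr_eq0P.
move=> /(_ (fun c _ => mul_conjC_ge0 (u r c)) c isT) /eqP.
by rewrite mul_conjC_eq0 => /eqP.
Qed.

(* If [x] kills the frame, [x u = 0] and [x (tri u) = 0]; on the last nonzero
   entry of [x] these two relations contradict each other. *)
Lemma frame_free u : cell_supp u -> (forall r, `|row r u| <= 1) ->
  row_free (frame u).
Proof.
move=> us u1; apply/inj_row_free => x x0.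
have xT q : \sum_r x 0 r * tri u r q = 0.
  have := congr1 (fun y : 'rV[C]_n => y 0 (sentry l q)) x0; rewrite !mxE => e.
  by rewrite -[RHS]e; apply: eq_bigr => r _; rewrite frame_sentry.
have xu c : \sum_r x 0 r * u r c = 0.
  have [/ssetP[q ->]|cl] := boolP (c \in sset l).
    by rewrite big1// => r _; rewrite cell_supp_sentry ?mulr0.
  have := congr1 (fun y : 'rV[C]_n => y 0 c) x0; rewrite !mxE => e.
  by rewrite -[RHS]e; apply: eq_bigr => r _; rewrite frame_out.
have xg q : \sum_r x 0 r * gram u r q = 0.
  under eq_bigr do rewrite gramE mulr_sumr.
  rewrite exchange_big /= big1// => c _.
  by under eq_bigr do rewrite mulrA; rewrite -mulr_suml xu mul0r.
have H j r : (k - j <= r)%N -> x 0 r = 0.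
  elim: j r => [|j IH] r; first by rewrite subn0 leqNgt ltn_ord.
  move=> jr; have xs s : (r < s)%N -> x 0 s = 0.
    by move=> rs; apply: IH; have := leq_ltn_trans jr rs; rewrite subnS; case: (k - j)%N.
  (* For [s < r] the two matrix entries cancel, and for [s > r] the coefficient [x 0 s] is already
     zero; only the positive diagonal term is left. *)
  have : \sum_s (x 0 s * tri u s r + x 0 s * gram u s r) = 0.
    by rewrite big_split /= xT xg addr0.
  rewrite (bigD1 r)//= big1 ?addr0; last first.
    move=> s sr; rewrite mxE (negbTE sr); case: (ltngtP s r) => [_|/xs->|/val_inj e].
    - by rewrite mulrN addNr.
    - by rewrite !mul0r addr0.
    - by rewrite e eqxx in sr.
  rewrite -mulrDr mxE eqxx => /eqP; rewrite mulf_eq0 => /orP[/eqP//|].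
  by rewrite gt_eqF// row_norm_gram.
by apply/rowP => r; rewrite mxE; apply: (H k); rewrite subnn.
Qed.

Lemma row_free_minor A : row_free A -> exists mu : schubert k n,
  minor A (sentry mu) != 0.
Proof.
move=> Af; have fA : row_full A^T by rewrite /row_full mxrank_tr.
have U := fullrowsub_unit fA; set f := fullrankfun fA in U.
have fI : injective f by exact: fullrankfun_inj.
have [mu muE] : exists mu : schubert k n, sset mu = [set f q | q : 'I_k]%SET.
  by apply: sset_surj; rewrite card_imset ?card_ord.
have [s sE] : exists s : 'S_k, forall q, f q = sentry mu (s q).
  by apply: sentry_perm => // q; rewrite muE; exact: imset_f.
exists mu; rewrite -(minor_perm_eq0 A sE) /minor -det_tr.
by rewrite -unitfE -unitmxE (_ : _^T = rowsub f A^T)//; apply/matrixP => i j; rewrite !mxE.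
Qed.

(** The conjugate of a phase is its inverse, so in a product of rows [r] and [s] the column phases
    cancel, and what remains is the inverse phase of pivot [r] times the phase of pivot [s]: exactly
    how an entry in pivot column [s] must scale. *)
Lemma frame_scale (alpha : 'I_n -> C) u u' : cell_supp u ->
  (forall c, `|alpha c| = 1) ->
  (forall r c, u' r c = (alpha (sentry l r))^-1 * u r c * alpha c) ->
  forall r c, frame u' r c = (alpha (sentry l r))^-1 * frame u r c * alpha c.
Proof.
move=> us a1 u'E r c.
have a0 d : alpha d != 0 by rewrite -normr_eq0 a1 oner_eq0.
have us' : cell_supp u' by move=> a d ad; rewrite u'E us// mulr0 mul0r.
have [/ssetP[q ->]|cl] := boolP (c \in sset l); last by rewrite !frame_out.
rewrite !frame_sentry// [tri u' _ _]mxE [tri u _ _]mxE; case: eqP => [->|_].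
  rewrite mulrAC mulVf// mul1r; congr (1 - _); apply: eq_mx_norm => i j.
  by rewrite !mxE u'E !normrM normfV !a1 invr1 mul1r mulr1.
case: ifP => _; last by rewrite mulr0 mul0r.
rewrite !gramE mulrN mulNr; congr (- _); rewrite mulr_sumr mulr_suml.
apply: eq_bigr => d _; rewrite !u'E !rmorphM fmorphV.
have aC e : (alpha e)^* = (alpha e)^-1.
  by apply: (mulfI (a0 e)); rewrite -normCK a1 expr1n mulfV.
rewrite /= !aC invrK; field; rewrite !a0//.
Qed.

(** Let [B] be the representative of [A] with identity pivot block. If [u] solves
    [tri u *m (B - emx) = u], then [frame u = tri u *m B], so the frame has the row space of [A]. *)
Lemma frame_solve A : minor A (sentry l) != 0 ->
  (forall r c, c \notin sset l -> (c < sentry l r)%N -> minor A (swap_entry l r c) = 0) ->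
  exists u, [/\ cell_supp u, forall r, `|row r u| < 1 &
    exists M, frame u = M *m A].
Proof.
move=> A0 Asw.
have AU : colsub (sentry l) A \in unitmx by rewrite unitmxE unitfE.
pose B := invmx (colsub (sentry l) A) *m A.
have Bl r q : B r (sentry l q) = (r == q)%:R.
  have := mulVmx AU => /matrixP/(_ r q); rewrite !mxE => <-.
  by apply: eq_bigr => s _; rewrite !mxE.
have BE r c : c \notin sset l -> (c < sentry l r)%N -> B r c = 0.
  by move=> cl cr; rewrite -(minor_swap _ _ Bl) minor_mulmx Asw// mulr0.
have [u ub u1] := tri_exists (B - emx).
have bs : cell_supp (B - emx).
  move=> r c; rewrite negb_and negbK -leqNgt mxE [(- emx) r c]mxE => /orP[/ssetP[q ->]|].
    by rewrite Bl emx_sentry subrr.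
  have [/ssetP[q ->]|cl] := boolP (c \in sset l); first by rewrite Bl emx_sentry subrr.
  rewrite emx_out// subr0 leq_eqVlt => /orP[/eqP/val_inj cr|]; last exact: BE.
  by rewrite cr sentry_sset in cl.
(* [tri u] is upper triangular, so row [r] of [u] combines rows [s >= r] of [B - emx], supported to
   the right of pivot [s] and therefore of pivot [r]. *)
have us : cell_supp u.
  move=> r c rc; rewrite -ub mxE big1// => s _; rewrite [tri _ _ _]mxE.
  have [rs|rs] := ltnP s r.
    by rewrite -val_eqE gtn_eqF// ltnNge ltnW// mul0r.
  rewrite bs ?mulr0//; apply: contra rc => /andP[cl lt]; rewrite /free_pos cl /=.
  by apply: leq_ltn_trans lt; rewrite sentry_leq.
exists u; split=> //; exists (tri u *m invmx (colsub (sentry l) A)).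
by rewrite -mulmxA -/B -[B](subrK emx) mulmxDr ub /frame addrC.
Qed.

(** The echelon entries are quotients of two minors, in which [g] cancels; equal echelon parts give
    equal [u] by [tri_unique]. *)
Lemma frame_inj u u' (g : C) : cell_supp u -> (forall r, `|row r u| < 1) ->
  cell_supp u' -> (forall r, `|row r u'| < 1) ->
  (forall f, minor (frame u) f = g * minor (frame u') f) -> u = u'.
Proof.
have ech v : cell_supp v -> (forall r, `|row r v| < 1) ->
    exists b, [/\ tri v *m b = v, (forall r c, c \in sset l -> b r c = 0) &
    forall r c, c \notin sset l ->
      b r c = minor (frame v) (swap_entry l r c) / minor (frame v) (sentry l)].
  move=> vs v1; pose b := invmx (tri v) *m v; have vU := tri_unit v1.
  have bl r c : c \in sset l -> b r c = 0.
    move=> /ssetP[q ->]; rewrite mxE big1// => s _.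
    by rewrite cell_supp_sentry ?mulr0.
  have fE : emx + b = invmx (tri v) *m frame v by rewrite mulmxDr mulKmx.
  exists b; split=> //; first by rewrite mulKVmx.
  move=> r c cl; have El a q : (emx + b) a (sentry l q) = (a == q)%:R.
    by rewrite mxE emx_sentry bl ?sentry_sset ?addr0.
  have -> : b r c = (emx + b) r c by rewrite [RHS]mxE emx_out ?add0r.
  rewrite -(minor_swap _ _ El) fE minor_mulmx det_inv mulrC frame_minor//.
  by rewrite det_tri.
move=> us u1 us' u1' H.
have [b [ub bl bE]] := ech _ us u1; have [b' [ub' bl' bE']] := ech _ us' u1'.
have g0 : g != 0.
  apply/eqP => g0; have := H (sentry l); rewrite g0 mul0r => /eqP.
  rewrite frame_minor// -det_tri; apply/negP.
  by rewrite -unitfE -unitmxE tri_unit.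
apply: (tri_unique ub u1 (u' := u')) => //; rewrite (_ : b = b')//.
apply/matrixP => r c; have [cl|cl] := boolP (c \in sset l); first by rewrite bl ?bl'.
by rewrite bE// bE'// !H -mulf_div divff ?mul1r.
Qed.

End CellFrames.

(** * The closed cell *)

Lemma exprz_sum (F : fieldType) (t : F) k (w : 'I_k -> int) : t != 0 ->
  t ^ (\sum_i w i) = \prod_i t ^ w i.
Proof.
by move=> t0; apply: (big_morph (fun x : int => t ^ x)) => // x y; rewrite exprzDr ?unitfE.
Qed.

Lemma norm_exprz1 (F : numFieldType) (t : F) (w : int) : `|t| = 1 -> `|t ^ w| = 1.
Proof.
move=> t1; case: w => w; first by rewrite -exprnP normrX t1 expr1n.
by rewrite NegzE -exprnN normfV normrX t1 expr1n invr1.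
Qed.

(** * Weighted scaling and the sup norm *)

Section WeightedAction.
Variables (R : realType) (m : nat) (b : 'I_m.+1 -> nat).
Hypothesis b1 : forall i, (1 <= b i)%N.
Local Notation C := (Cplx R).
Implicit Types (z : 'rV[C]_m.+1) (t s : C).

Lemma wactE t z i : wact b t z 0 i = t ^+ b i * z 0 i.
Proof. by rewrite mxE. Qed.

Lemma wactM t s z : wact b t (wact b s z) = wact b (t * s) z.
Proof. by apply/rowP => i; rewrite !wactE mulrA exprMn. Qed.

Lemma wact1 z : wact b 1 z = z.
Proof. by apply/rowP => i; rewrite wactE expr1n mul1r. Qed.

Lemma wact_eq0 t z i : t != 0 -> (wact b t z 0 i == 0) = (z 0 i == 0).
Proof. by move=> t0; rewrite wactE mulf_eq0 expf_eq0 (negbTE t0) andbF. Qed.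

Lemma wactK t z : t != 0 -> wact b t^-1 (wact b t z) = z.
Proof. by move=> t0; rewrite wactM mulVf// wact1. Qed.

Lemma wact_neq0 t z : t != 0 -> z != 0 -> wact b t z != 0.
Proof.
move=> t0; apply: contra_neq => z0.
by rewrite -(wactK z t0) z0; apply/rowP => i; rewrite wactE !mxE mulr0.
Qed.

Lemma wact_norm t z : `|t| = 1 -> `|wact b t z| = `|z|.
Proof.
move=> t1; apply: eq_mx_norm => i j.
by rewrite !ord1 wactE normrM normrX t1 expr1n mul1r.
Qed.

Lemma wact_norm_le t z : `|t| <= 1 -> `|wact b t z| <= `|t| * `|z|.
Proof.
move=> t1; apply: mx_norm_le => [|i j]; first by rewrite mulr_ge0.
rewrite ord1 wactE normrM normrX ler_pM ?exprn_ge0 ?le_entry_mx_norm//.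
by rewrite -(prednK (b1 j)) exprS ler_piMr// exprn_ile1.
Qed.

(** One of [t] and its inverse has modulus at most 1, and [wact_norm_le] forbids that one to keep
    the norm unless the modulus is 1. *)
Lemma wact_norm_eq1 t z : t != 0 -> `|z| = 1 -> `|wact b t z| = 1 -> `|t| = 1.
Proof.
move=> t0 z1 tz1; have /orP[t1|t1] : (`|t| <= 1) || (1 <= `|t|).
  by rewrite real_leVge ?normr_real.
  by apply/le_anti; rewrite t1 -tz1 (le_trans (wact_norm_le _ t1))// z1 mulr1.
have tV1 : `|t^-1| <= 1 by rewrite normfV invf_le1// normr_gt0.
have := wact_norm_le (wact b t z) tV1; rewrite wactK// z1 tz1 mulr1 => t1'.
by apply/le_anti; rewrite t1 andbT -invf_ge1 ?normr_gt0// -normfV.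
Qed.

(** The norm of [v] is the gauge homogeneous for the weights, the maximum of [|z_i|] to the power
    [1 / b_i]; its inverse is the required scalar. *)
Lemma wact_normalize z : z != 0 -> exists2 s : C, 0 < s & `|wact b s z| = 1.
Proof.
move=> z0; pose v : 'rV[C]_m.+1 := \row_i (b i).-root `|z 0 i|.
have rootE i : `|v 0 i| ^+ b i = `|z 0 i|.
  by rewrite mxE ger0_norm ?rootC_ge0 ?rootCK ?normr_ge0 ?(b1 i).
have v0 : v != 0.
  apply: contra_neq z0 => v0; apply/rowP => i; rewrite mxE; apply/eqP.
  by rewrite -normr_eq0 -rootE v0 mxE normr0 expf_eq0 (b1 i) eqxx.
have s0 : 0 < `|v|^-1 by rewrite invr_gt0 normr_gt0.
have E i : `|wact b `|v|^-1 z 0 i| = (`|v|^-1 * `|v 0 i|) ^+ b i.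
  by rewrite wactE normrM normrX (gtr0_norm s0) -rootE exprMn.
exists `|v|^-1 => //; apply/le_anti/andP; split.
  apply: mx_norm_le => // i j; rewrite ord1 E exprn_ile1 ?mulr_ge0 ?(ltW s0)//.
  by rewrite mulrC ler_pdivrMr ?normr_gt0// mul1r le_entry_mx_norm.
have [i [j]] := mx_norm_attained v0; rewrite ord1 => vj.
apply: le_trans (le_entry_mx_norm _ 0 j).
by rewrite E -vj mulVf ?normr_eq0// expr1n.
Qed.

Lemma wact_normalize_pos z p : z 0 p != 0 ->
  exists t : C, [/\ t != 0, `|wact b t z| = 1 & 0 < wact b t z 0 p].
Proof.
move=> zp; have z0 : z != 0 by apply: contra_neq zp => ->; rewrite mxE.
have [s s0 sz] := wact_normalize z0.
pose x := wact b s z 0 p; have x0 : x != 0 by rewrite wact_eq0// gt_eqF.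
pose t := (b p).-root (`|x| / x).
have tb : t ^+ b p = `|x| / x by rewrite rootCK ?(b1 p).
have t1 : `|t| = 1.
  apply: (@pexpIrn _ (b p)); rewrite ?nnegrE ?normr_ge0 ?ler01 ?(b1 p)//.
  by rewrite -normrX tb normrM normfV normr_id divff ?normr_eq0// expr1n.
exists (t * s); rewrite -wactM; split.
- by rewrite mulf_neq0 ?(gt_eqF s0)// -normr_eq0 t1 oner_eq0.
- by rewrite wact_norm.
- by rewrite wactE tb -/x mulfVK// normr_gt0.
Qed.

End WeightedAction.

(** * The parametrization of a cell by frames *)

Section Cells.
Variables (R : realType) (k n m : nat) (lam : 'I_m.+1 -> schubert k n).
Hypotheses (k0 : (0 < k)%N) (kn : (k < n)%N).
Hypothesis hlam : schubert_order lam.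
Variable b : 'I_m.+1 -> nat.
Hypothesis hb : plucker_weight lam b.
Local Notation C := (Cplx R).
Implicit Types (z y : 'rV[C]_m.+1) (t s : C) (p i j : 'I_m.+1) (r : 'I_k) (c : 'I_n).

Let b1 : forall i, (1 <= b i)%N := hb.1.

(** Scaling column [a] by [t ^ w a] and a single row by [t ^ c] multiplies the minor of [lam i] by
    [t ^ b i]. The additive form of the weights is what makes this possible. *)
Lemma wact_Pl t z : t != 0 -> Pl R lam z -> Pl R lam (wact b t z).
Proof.
move=> t0 /PlP -/(_ hlam)[z0 [A AE]]; apply/PlP => //; split; first exact: wact_neq0.
have [w [c wE]] := plucker_weight_sum k0 kn hlam hb.
pose alpha r : C := if r == Ordinal k0 then t ^ c else 1.
exists (\matrix_(r, a) (alpha r * A r a * t ^ w a)) => i.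
rewrite (@minor_scale _ _ _ alpha (fun a => t ^ w a) A); last first.
  by move=> r a; rewrite mxE.
rewrite wactE AE; congr (_ * _).
rewrite (bigD1 (Ordinal k0))//= big1 ?mulr1; last first.
  by move=> r r0; rewrite /alpha (negbTE r0).
by rewrite /alpha eqxx exprnP wE big_sset exprzDr ?unitfE// exprz_sum.
Qed.

(** The default [ord0] is never returned for want of a symbol when [c] lies outside [lam p], since
    the exchanged set then has [k] elements. *)
Definition swap_idx p r c : 'I_m.+1 :=
  odflt ord0 [pick i | sset (lam i) == (c |: (sset (lam p) :\ sentry (lam p) r))%SET].

Lemma swap_idxE p r c : c \notin sset (lam p) ->
  sset (lam (swap_idx p r c)) = (c |: (sset (lam p) :\ sentry (lam p) r))%SET.
Proof.
move=> /(swap_card r) /(sset_lam_surj hlam)[i iE]; rewrite /swap_idx.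
by case: pickP => [j /eqP//|/(_ i)]; rewrite iE eqxx.
Qed.

Lemma swap_idx_raised p r c : free_pos (lam p) r c ->
  raised (lam p) (lam (swap_idx p r c)).
Proof. by move=> /andP[cl rc]; apply: (swap_raised cl rc); exact: swap_idxE. Qed.

Lemma raised_swap_idx p j : raised (lam p) (lam j) ->
  exists r c, free_pos (lam p) r c /\ swap_idx p r c = j.
Proof.
move=> /raised_swap[r [c [cl rc jE]]]; exists r, c; split; first exact/andP.
by apply: (sset_lam_inj hlam); rewrite swap_idxE.
Qed.

Lemma swap_idx_lt p r c : c \notin sset (lam p) -> (c < sentry (lam p) r)%N ->
  (swap_idx p r c < p)%N.
Proof.
move=> cl cr; rewrite ltn_neqAle (lam_le hlam) ?andbT; last first.
  by apply: (swap_le cl cr); exact: swap_idxE.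
apply: contra (cl) => /eqP/val_inj e; have := swap_idxE r cl.
by rewrite e => ->; rewrite !inE eqxx.
Qed.

Definition cell_disc p : set 'rV[C]_m.+1 :=
  [set y : 'rV[C]_m.+1 | (forall j, ~ raised (lam p) (lam j) -> y 0 j = 0) /\ `|y| <= 1]%classic.

Definition coordmx p y : 'M[C]_(k, n) :=
  \matrix_(r, c) if free_pos (lam p) r c then y 0 (swap_idx p r c) else 0.

Definition minors (A : 'M[C]_(k, n)) : 'rV[C]_m.+1 :=
  \row_i minor A (sentry (lam i)).

Definition cell_vec p y : 'rV[C]_m.+1 := minors (frame (lam p) (coordmx p y)).

Definition cell_map p y : 'rV[C]_m.+1 := `|cell_vec p y|^-1 *: cell_vec p y.

Lemma coordmx_supp p y : cell_supp (lam p) (coordmx p y).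
Proof. by move=> r c /negbTE rc; rewrite mxE rc. Qed.

Arguments coordmx_supp : clear implicits.

Lemma coordmx_norm p y r : `|row r (coordmx p y)| <= `|y|.
Proof.
apply: mx_norm_le => // i c; rewrite !mxE; case: ifP => _; last by rewrite normr0.
exact: le_entry_mx_norm.
Qed.

Lemma coordmx_inj p y y' : cell_disc p y -> cell_disc p y' ->
  coordmx p y = coordmx p y' -> y = y'.
Proof.
move=> [yE _] [yE' _] /matrixP e; apply/rowP => j.
have [/raised_swap_idx[r [c [rc <-]]]|nr] := pselect (raised (lam p) (lam j)).
  by have := e r c; rewrite !mxE rc.
by rewrite yE// yE'.
Qed.

Lemma cell_vec_neq0 p y : cell_disc p y -> cell_vec p y != 0.
Proof.
move=> [yE y1]; have us := coordmx_supp p y.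
have /row_free_minor[mu] : row_free (frame (lam p) (coordmx p y)).
  by apply: frame_free => // r; exact: le_trans (coordmx_norm _ _ _) y1.
have [i <-] := lam_surj hlam mu.
by apply: contra_neq => /rowP/(_ i); rewrite !mxE.
Qed.

Lemma cell_vecE p y : cell_disc p y -> cell_vec p y = `|cell_vec p y| *: cell_map p y.
Proof.
by move=> yD; rewrite scalerA divff ?scale1r// normr_eq0 cell_vec_neq0.
Qed.

Lemma cell_map_eq0 p y i : cell_disc p y ->
  (cell_map p y 0 i == 0) = (cell_vec p y 0 i == 0).
Proof.
move=> yD; rewrite mxE mulf_eq0 invr_eq0 normr_eq0.
by rewrite (negbTE (cell_vec_neq0 yD)).
Qed.

Lemma cell_map_norm p y : cell_disc p y -> `|cell_map p y| = 1.
Proof.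
move=> yD; rewrite normrZ normfV normr_id mulVf// normr_eq0.
exact: cell_vec_neq0.
Qed.

Lemma cell_map_Pl p y : cell_disc p y -> Pl R lam (cell_map p y).
Proof.
move=> yD; apply/PlP => //; split; first by rewrite -normr_eq0 cell_map_norm// oner_eq0.
pose g := `|cell_vec p y|^-1; pose A := frame (lam p) (coordmx p y).
pose alpha r : C := if r == Ordinal k0 then g else 1.
exists (\matrix_(r, a) (alpha r * A r a * 1)) => i.
rewrite (@minor_scale _ _ _ alpha (fun=> 1) A); last by move=> r a; rewrite mxE.
rewrite big1_eq mulr1 (bigD1 (Ordinal k0))//= big1 ?mulr1; last first.
  by move=> r r0; rewrite /alpha (negbTE r0).
by rewrite /alpha eqxx !mxE.
Qed.

Lemma cell_map_lt p y j : cell_disc p y -> (j < p)%N -> cell_map p y 0 j = 0.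
Proof.
move=> yD jp; apply/eqP; rewrite cell_map_eq0// mxE; apply: contraTT jp.
by move=> /(frame_minor_le (coordmx_supp p y))/(lam_le hlam); rewrite -leqNgt.
Qed.

Lemma cell_map_pos p y : cell_disc p y -> `|y| < 1 -> 0 < cell_map p y 0 p.
Proof.
move=> yD y1; rewrite mxE mulr_gt0 ?invr_gt0 ?normr_gt0 ?cell_vec_neq0// mxE.
rewrite frame_minor; last exact: coordmx_supp.
by apply: prodr_gt0 => r _; rewrite subr_gt0 (le_lt_trans (coordmx_norm _ _ _)).
Qed.

(** The sup norm is attained at one coordinate, which is an entry of some row [r] of the coordinate
    matrix. That row has norm 1, and the factor [1 - |u_r|] vanishes. *)
Lemma cell_map_boundary p y : cell_disc p y -> `|y| = 1 -> cell_map p y 0 p = 0.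
Proof.
move=> yD y1; apply/eqP; rewrite cell_map_eq0// mxE frame_minor; last exact: coordmx_supp.
have y0 : y != 0 by rewrite -normr_eq0 y1 oner_eq0.
have [i [j]] := mx_norm_attained y0; rewrite ord1 y1 => yj.
have [nr|] := pselect (~ raised (lam p) (lam j)).
  by move: yj; rewrite yD.1// normr0 => /eqP; rewrite oner_eq0.
move=> /contrapT /raised_swap_idx[r [c [rc je]]].
apply/prodf_eq0; exists r => //; rewrite subr_eq0; apply/eqP/le_anti/andP; split.
  rewrite yj -je (_ : y 0 _ = row r (coordmx p y) 0 c) ?le_entry_mx_norm//.
  by rewrite !mxE rc.
by rewrite -y1 coordmx_norm.
Qed.

Lemma minor_lam_scale (A A' : 'M[C]_(k, n)) g :
  (forall i, minor A (sentry (lam i)) = g * minor A' (sentry (lam i))) ->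
  forall f, minor A f = g * minor A' f.
Proof.
move=> H f; have [fI|fI] := pselect (injective f); last first.
  by rewrite !minor_noninj ?mulr0.
have [i iE] : exists i, sset (lam i) = [set f q | q : 'I_k]%SET.
  by apply: (sset_lam_surj hlam); rewrite card_imset ?card_ord.
have [s sE] : exists s : 'S_k, forall q, f q = sentry (lam i) (s q).
  by apply: sentry_perm => // q; rewrite iE; apply: imset_f.
by rewrite !(eq_minor _ sE) !(minor_perm _ (sentry (lam i))) H mulrCA.
Qed.

Lemma cell_map_inj p y y' : cell_disc p y -> `|y| < 1 ->
  cell_disc p y' -> `|y'| < 1 -> cell_map p y = cell_map p y' -> y = y'.
Proof.
move=> yD y1 yD' y1' e; apply: (coordmx_inj yD yD').
apply: (@frame_inj _ _ _ (lam p) _ _ (`|cell_vec p y| / `|cell_vec p y'|)).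
- exact: coordmx_supp.
- by move=> r; exact: le_lt_trans (coordmx_norm _ _ _) y1.
- exact: coordmx_supp.
- by move=> r; exact: le_lt_trans (coordmx_norm _ _ _) y1'.
apply: minor_lam_scale => i.
have vE v : cell_disc p v -> cell_vec p v 0 i = `|cell_vec p v| * cell_map p v 0 i.
  by move=> /cell_vecE/(congr1 (fun z : 'rV[C]_m.+1 => z 0 i)); rewrite /= [RHS]mxE.
transitivity (cell_vec p y 0 i); first by rewrite [RHS]mxE.
rewrite (vE _ yD) e.
transitivity (`|cell_vec p y| / `|cell_vec p y'| * cell_vec p y' 0 i).
  have g0 : `|cell_vec p y'| != 0 by rewrite normr_eq0 cell_vec_neq0.
  have := vE _ yD'; set a := cell_vec p y' 0 i; set x := cell_map p y' 0 i => ->.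
  by rewrite mulrA (mulfVK g0).
by rewrite [cell_vec p y' 0 i]mxE.
Qed.

Lemma cell_map_surj p z : Pl R lam z -> `|z| = 1 ->
  (forall j, (j < p)%N -> z 0 j = 0) -> 0 < z 0 p ->
  exists y, [/\ cell_disc p y, `|y| < 1 & cell_map p y = z].
Proof.
move=> /PlP -/(_ hlam)[z0 [A AE]] z1 zlt zp.
have Ap : minor A (sentry (lam p)) != 0 by rewrite -AE gt_eqF.
(* An exchange that lowers a pivot gives a symbol of index below [p], where [z] vanishes; this
   provides the hypothesis of [frame_solve]. *)
have [r c cl cr|u [us u1 [M uM]]] := frame_solve Ap.
  have [s sE] := swap_sset cl (swap_idxE r cl).
  by apply/eqP; rewrite (minor_perm_eq0 A sE) -AE zlt// swap_idx_lt.
(* Inverts [coordmx]. The choice made by [pick] is harmless, because an exchange is determined by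
   the symbol that it produces ([swap_inj]). *)
pose y : 'rV[C]_m.+1 := \row_j
  if [pick rc | free_pos (lam p) rc.1 rc.2 && (swap_idx p rc.1 rc.2 == j)] is Some rc
  then u rc.1 rc.2 else 0.
have uy : coordmx p y = u.
  apply/matrixP => r c; rewrite !mxE; case: ifP => rc; last by rewrite us ?rc.
  case: pickP => [[r' c'] /= /andP[rc' /eqP e]|/(_ (r, c))/=]; last by rewrite rc eqxx.
  have cl := andP rc; have cl' := andP rc'.
  have [-> ->//] : r' = r /\ c' = c.
  by apply: (@swap_inj _ _ (lam p)); rewrite ?cl.1 ?cl'.1// -!swap_idxE ?cl.1 ?cl'.1// e.
have y1 : `|y| < 1.
  apply: mx_norm_lt => // i j; rewrite !mxE; case: pickP => [[r c] _|_] /=.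
    apply: le_lt_trans (u1 r).
    by rewrite (_ : u r c = row r u 0 c) ?le_entry_mx_norm// mxE.
  by rewrite normr0.
have yD : cell_disc p y.
  split; last exact: ltW.
  move=> j nr; rewrite mxE; case: pickP => // [[r c] /= /andP[rc /eqP je]].
  by exfalso; apply: nr; rewrite -je; exact: swap_idx_raised.
exists y; split=> //.
have vE : cell_vec p y = \det M *: z.
  by apply/rowP => i; rewrite !mxE uy uM minor_mulmx -AE.
(* Both vectors have a positive [p]-th coordinate, so the factor between them is positive and
   normalization gives back [z] itself, with no phase left over. *)
have M0 : 0 < \det M.
  have : 0 < cell_vec p y 0 p.
    rewrite mxE uy frame_minor//; apply: prodr_gt0 => r _.
    by rewrite subr_gt0.
  by rewrite vE mxE pmulr_lgt0.
by rewrite /cell_map vE normrZ z1 mulr1 scalerA gtr0_norm// mulVf ?scale1r// gt_eqF.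
Qed.

Lemma cell_disc_wact p t y : `|t| = 1 -> cell_disc p y -> cell_disc p (wact b t y).
Proof.
move=> t1 [yE y1]; split; last by rewrite wact_norm.
by move=> j /yE e; rewrite wactE e mulr0.
Qed.

(** The coordinate of the exchange of pivot [r] for [c] has weight
    [b p + w c - w (sentry (lam p) r)], and [t ^+ b p = 1] turns its factor into the phases of
    [frame_scale]. The minor of [lam i] is then multiplied by [t] to the power [b i - b p], that is
    by [t ^+ b i]. *)
Lemma cell_map_wact p t y : `|t| = 1 -> t ^+ b p = 1 ->
  cell_map p (wact b t y) = wact b t (cell_map p y).
Proof.
move=> t1 tb; have [w [c0 wE]] := plucker_weight_sum k0 kn hlam hb.
have t0 : t != 0 by rewrite -normr_eq0 t1 oner_eq0.
have tU : t \is a GRing.unit by rewrite unitfE.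
have E r c : coordmx p (wact b t y) r c =
    (t ^ w (sentry (lam p) r))^-1 * coordmx p y r c * t ^ w c.
  rewrite !mxE; case: ifP => [/andP[cl rc]|_]; last by rewrite mulr0 mul0r.
  rewrite mulrAC; congr (_ * _).
  have : (b (swap_idx p r c))%:Z = (b p)%:Z + (- w (sentry (lam p) r) + w c).
    rewrite !wE swap_idxE// big_setU1 ?inE -?mem_sset ?(negbTE cl) ?andbF//=.
    rewrite (big_setD1 (sentry (lam p) r) (sentry_sset (lam p) r))/=.
    by ring.
  by rewrite exprnP => ->; rewrite !exprzDr// -exprnP tb mul1r -invr_expz.
have vE : cell_vec p (wact b t y) = wact b t (cell_vec p y).
  apply/rowP => i; rewrite wactE ![cell_vec _ _ _ _]mxE.
  rewrite (@minor_scale _ _ _ (fun r => (t ^ w (sentry (lam p) r))^-1)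
     (fun c => t ^ w c) (frame (lam p) (coordmx p y))); last first.
    apply: (@frame_scale _ _ _ (lam p) (fun c => t ^ w c)) => [||//].
      exact: coordmx_supp.
    by move=> c; exact: norm_exprz1.
  congr (_ * _); rewrite prodfV -!exprz_sum// -!big_sset.
  have -> : t ^+ b i = t ^ (b i)%:Z / t ^ (b p)%:Z by rewrite -!exprnP tb divr1.
  by rewrite !invr_expz -!exprzDr// !wE; congr (_ ^ _); ring.
by rewrite /cell_map vE wact_norm//; apply/rowP => i; rewrite !(mxE, wactE) mulrCA.
Qed.

End Cells.

Local Open Scope classical_set_scope.

(** * Limits and compactness *)

Section MatrixLimits.
Variables (K : numFieldType) (T : Type) (F : set_system T).
Context {FF : Filter F}.

Lemma cvg_mx p q (f : T -> 'M[K]_(p, q)) (l : 'M[K]_(p, q)) :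
  (forall i j, f x i j @[x --> F] --> l i j) -> f @ F --> l.
Proof.
move=> fl A [P lP PA]; apply: (@filterS _ F _ (fun x => forall ij, P ij.1 ij.2 (f x ij.1 ij.2))).
  by move=> x Px; apply: PA => i j; exact: (Px (i, j)).
by apply: filter_forall => -[i j]; exact: (fl i j _ (lP i j)).
Qed.

Lemma cvg_coord p q (f : T -> 'M[K]_(p, q)) (l : 'M[K]_(p, q)) i j :
  f @ F --> l -> f x i j @[x --> F] --> l i j.
Proof. by move=> fl; exact: (cvg_comp _ _ fl (@coord_continuous K p q i j l)). Qed.

Lemma cvg_bigsum (I : Type) (r : seq I) (P : pred I) (f : I -> T -> K) (l : I -> K) :
  (forall i, f i @ F --> l i) ->
  (\sum_(i <- r | P i) f i x) @[x --> F] --> \sum_(i <- r | P i) l i.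
Proof.
move=> fl; elim: r => [|i r IH].
  by rewrite big_nil; under eq_fun do rewrite big_nil; exact: cvg_cst.
rewrite big_cons; under eq_fun do rewrite big_cons.
by case: (P i) => //; apply: cvgD.
Qed.

Lemma cvg_bigprod (I : Type) (r : seq I) (P : pred I) (f : I -> T -> K) (l : I -> K) :
  (forall i, f i @ F --> l i) ->
  (\prod_(i <- r | P i) f i x) @[x --> F] --> \prod_(i <- r | P i) l i.
Proof.
move=> fl; elim: r => [|i r IH].
  by rewrite big_nil; under eq_fun do rewrite big_nil; exact: cvg_cst.
rewrite big_cons; under eq_fun do rewrite big_cons.
by case: (P i) => //; apply: cvgM.
Qed.

Lemma cvg_exprn (f : T -> K) (l : K) e : f @ F --> l -> f x ^+ e @[x --> F] --> l ^+ e.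
Proof.
move=> fl; elim: e => [|e IH].
  by rewrite expr0; under eq_fun do rewrite expr0; exact: cvg_cst.
by rewrite exprS; under eq_fun do rewrite exprS; apply: cvgM.
Qed.

Lemma cvg_mulmx p q s (f : T -> 'M[K]_(p, q)) (g : T -> 'M[K]_(q, s))
    (A : 'M[K]_(p, q)) (B : 'M[K]_(q, s)) :
  f @ F --> A -> g @ F --> B -> f x *m g x @[x --> F] --> A *m B.
Proof.
move=> fA gB; apply: cvg_mx => i j; rewrite mxE; under eq_fun do rewrite mxE.
by apply: cvg_bigsum => a; apply: cvgM; exact: cvg_coord.
Qed.

Lemma cvg_det p (f : T -> 'M[K]_p) (A : 'M[K]_p) :
  f @ F --> A -> \det (f x) @[x --> F] --> \det A.
Proof.
move=> fA; apply: cvg_bigsum => s; apply: cvgM; first exact: cvg_cst.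
by apply: cvg_bigprod => i; exact: cvg_coord.
Qed.

End MatrixLimits.

Lemma cvg_conj (K : numClosedFieldType) (T : Type) (F : set_system T) {FF : Filter F}
  (f : T -> K) (l : K) : f @ F --> l -> (f x)^* @[x --> F] --> l^*.
Proof.
move=> /cvgrPdist_lt fl; apply/cvgrPdist_lt => e /fl; apply: filterS => x.
by rewrite -rmorphB norm_conjC.
Qed.

Section ComplexDisc.
Variable R : realType.
Local Notation C := (Cplx R).
Import complex.
Local Open Scope complex_scope.

Lemma real_complex_continuous : continuous (fun x : R => x%:C : C).
Proof.
move=> x; apply/(@cvgrPdist_lt C C^o) => e e0.
have eE : (Re e)%:C = e :> C by apply: RRe_real; exact: gtr0_real.
have e0' : 0 < Re e by rewrite -(ltcR 0 (Re e)) eE.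
have : id y @[y --> x] --> x by exact: cvg_id.
move/cvgrPdist_lt => /(_ _ e0'); apply: filterS => y xy.
by rewrite -rmorphB normc_def /= expr0n addr0 sqrtr_sqr -eE ltcR.
Qed.

Lemma norm_le_closed (V : normedModType C) (r : C) : 0 <= r -> closed [set x : V | `|x| <= r].
Proof.
move=> r0; rewrite -[X in closed X]setCK; apply: open_closedC; rewrite openE => x /= xr.
have rx : r < `|x| by rewrite real_ltNge ?ger0_real//; exact/negP.
have : id y @[y --> x] --> x by exact: cvg_id.
move/cvgrPdist_lt => /(_ (`|x| - r)); rewrite subr_gt0 => /(_ rx).
apply: filterS => y; rewrite ltrBrDl => xy /= yr.
have := le_lt_trans (ler_normB (x - y) (- y)) _; rewrite opprK subrK.
move=> /(_ `|x|); rewrite normrN ltxx => H.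
by suff : false by []; apply: H; rewrite addrC (le_lt_trans _ xy)// lerD2r.
Qed.

Lemma complex_disc_compact (r : R) : 0 <= r -> compact [set x : C | `|x| <= r%:C].
Proof.
move=> r0; pose phi (ab : R * R) : C := ab.1%:C + 'i * ab.2%:C.
have phic : continuous phi.
  move=> ab; apply: (@cvgD C C^o).
    by apply: (continuous_comp (f := fst) (g := fun x : R => x%:C : C));
      [exact: cvg_fst|exact: real_complex_continuous].
  apply: cvgM; first exact: cvg_cst.
  by apply: (continuous_comp (f := snd) (g := fun x : R => x%:C : C));
      [exact: cvg_snd|exact: real_complex_continuous].
have box : compact (phi @` (`[- r, r]%classic `*` `[- r, r]%classic)).
  apply: continuous_compact; first exact: continuous_subspaceT.
  by apply: compact_setX; exact: segment_compact.
apply: (subclosed_compact _ box).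
  by apply: (@norm_le_closed C^o); rewrite ler0c.
move=> x /= xr; exists (Re x, Im x); last by rewrite /phi /= -complexE.
by split; rewrite /= in_itv /= -ler_norml -lecR; apply: le_trans xr;
  rewrite normc_def lecR -sqrtr_sqr ler_wsqrtr// ?lerDl ?lerDr sqr_ge0.
Qed.

End ComplexDisc.

(** * Quotient spaces *)

Section QuotSpace.
Variables (T : topologicalType) (r : T -> T -> Prop).

Lemma quot_projP x y :
  quot_proj r x = quot_proj r y <-> clos_refl_sym_trans T r x y.
Proof.
rewrite /quot_proj; split=> [|xy].
  by move=> /(generic_quotient.eqmodP (gen_equiv_equiv r)) /asboolP.
by apply/(generic_quotient.eqmodP (gen_equiv_equiv r))/asboolP.
Qed.

Lemma quot_proj_eq x y : r x y -> quot_proj r x = quot_proj r y.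
Proof. by move=> xy; apply/quot_projP; exact: rst_step. Qed.

Lemma quot_proj_surj q : exists x, quot_proj r x = q.
Proof. by exists (repr q); exact: reprK. Qed.

Lemma quot_proj_continuous : continuous (quot_proj r).
Proof. exact: pi_continuous. Qed.

Lemma quot_lift (Z : topologicalType) (f : T -> Z) :
  (forall x y, r x y -> f x = f y) -> continuous f ->
  exists2 g : quot_space r -> Z, continuous g & forall x, g (quot_proj r x) = f x.
Proof.
move=> fr fc; have frst x y : clos_refl_sym_trans T r x y -> f x = f y.
  by elim=> [x' y' /fr|x'|x' y' _ ->|x' y' z' _ -> _ ->].
have E x : f (repr (quot_proj r x)) = f x.
  by apply/frst/quot_projP; exact: reprK.
exists (f \o repr) => //.
by apply/quotient_continuous => x; rewrite (_ : _ \o _ = f)//; exact/funext.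
Qed.

Hypothesis r_equiv : equivalence T r.

Lemma quot_proj_equiv x y : quot_proj r x = quot_proj r y <-> r x y.
Proof.
split=> [/quot_projP|]; last exact: quot_proj_eq.
elim=> [//|x'|x' y' _|x' y' z' _ xy _].
- exact: (Relation_Definitions.equiv_refl _ _ r_equiv).
- exact: (Relation_Definitions.equiv_sym _ _ r_equiv).
- exact: (Relation_Definitions.equiv_trans _ _ r_equiv _ _ _ xy).
Qed.

(** The saturation of [U] is the union of its preimages under the action maps. *)
Lemma quot_proj_open (G : Type) (D : set G) (a : G -> T -> T) (U : set T) :
  (forall g, D g -> continuous (a g)) ->
  (forall x y, r x y <-> exists2 g, D g & y = a g x) ->
  open U -> open (quot_proj r @` U).
Proof.
move=> ac ra oU; rewrite /open /= /quotient_open.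
rewrite (_ : _ @^-1` _ = \bigcup_(g in D) (a g @^-1` U)).
  by apply: bigcup_open => g Dg; apply: open_comp => // x _; exact: ac.
apply/seteqP; split=> x /=.
  move=> [y Uy /quot_proj_equiv /(Relation_Definitions.equiv_sym _ _ r_equiv)/ra[g Dg yE]].
  by exists g; rewrite //= -yE.
move=> [g Dg /= Ugx]; exists (a g x) => //; apply/quot_proj_equiv.
by apply: (Relation_Definitions.equiv_sym _ _ r_equiv); apply/ra; exists g.
Qed.

End QuotSpace.

(** The product of a quotient map with an identity need not be a quotient map; for open [q] it is,
    whatever [I] may be. It serves to define maps on a lens complex times the interval. *)
Lemma continuous_quot_prod (Y Q I Z : topologicalType) (q : Y -> Q) (F : Q * I -> Z) :
  (forall x, exists y, q y = x) -> (forall U, open U -> open (q @` U)) ->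
  continuous (fun yi : Y * I => F (q yi.1, yi.2)) -> continuous F.
Proof.
move=> qs qo Fc [x i] V VF; have [y yx] := qs x.
have := Fc (y, i) V; rewrite /= yx => /(_ VF) [[A B] /= [Ay Bi] AB].
have [A' [oA' A'y] A'A] : exists2 A', open_nbhs y A' & A' `<=` A.
  by move: Ay; rewrite nbhsE.
exists (q @` A', B) => /=.
  split=> //; apply: open_nbhs_nbhs; split; first exact: qo.
  by exists y.
by move=> [_ j] /= [[a A'a <-] Bj]; apply: (AB (a, j)); split=> //; exact: A'A.
Qed.

Lemma continuous_set_type (X Y : topologicalType) (A : set Y) (f : X -> set_type A) :
  continuous (fun x => set_val (f x)) -> continuous f.
Proof. exact: continuous_comp_initial. Qed.

Lemma set_val_continuous (Y : topologicalType) (A : set Y) :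
  continuous (set_val : set_type A -> Y).
Proof. exact: initial_continuous. Qed.

Lemma set_val_in (Y : Type) (A : set Y) (x : set_type A) : A (set_val x).
Proof. exact: set_mem (valP x). Qed.

Definition set_elt (Y : Type) (A : set Y) (x : Y) (Ax : A x) : set_type A :=
  exist _ x (mem_set Ax).

Lemma set_val_inj (Y : Type) (A : set Y) (x y : set_type A) :
  set_val x = set_val y -> x = y.
Proof. by move=> /val_inj. Qed.

Lemma compact_set_type (Y : topologicalType) (A : set Y) :
  compact A -> compact [set: set_type A].
Proof.
move=> Ac F FF _; have GF : ProperFilter (set_val @ F) by exact: fmap_proper_filter.
have GA : (set_val @ F) A.
  by apply: (@filterS _ F _ setT) => [x _|]; [exact: set_val_in|exact: filterT].
have [x [Ax xF]] := Ac _ GF GA.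
exists (set_elt Ax); split=> // U V FU [W [[W' oW' <-] W'x] WV].
have UF : (set_val @ F) (set_val @` U) by apply: (@filterS _ F _ U) => // u Uu; exists u.
have nW : nbhs x W' by exact: open_nbhs_nbhs.
have [_ [[u Uu <-] W'u]] := xF _ _ UF nW.
by exists u; split=> //; exact: WV.
Qed.

Lemma hausdorff_inj (X Y : topologicalType) (f : X -> Y) :
  continuous f -> injective f -> hausdorff_space Y -> hausdorff_space X.
Proof.
move=> fc fI hY p q pq; apply/fI/hY => A B Afp Bfq.
by have [x [Ax Bx]] := pq _ _ (fc _ _ Afp) (fc _ _ Bfq); exists (f x).
Qed.

Lemma compact_hausdorff_homeomorphism (X Y : topologicalType) (h : X -> Y) :
  compact [set: X] -> hausdorff_space Y -> continuous h -> injective h ->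
  (forall y, exists x, h x = y) -> homeomorphism h.
Proof.
move=> cX hY hc hI /choice[g hg]; split=> //; exists g; split=> //; last first.
  by move=> x; apply: hI; rewrite hg.
apply/continuous_closedP => A cA; rewrite (_ : g @^-1` A = h @` A).
  apply: compact_closed => //; apply: continuous_compact.
    exact: continuous_subspaceT.
  exact: (subclosed_compact cA cX).
apply/seteqP; split=> [y Ay|_ [x Ax <-]]; first by exists (g y).
by rewrite /= (_ : g (h x) = x)//; apply: hI; rewrite hg.
Qed.

Lemma quot_space_compact (T : topologicalType) (r : T -> T -> Prop) :
  compact [set: T] -> compact [set: quot_space r].
Proof.
move=> cT; rewrite (_ : setT = quot_proj r @` setT).
  by apply: continuous_compact cT; apply: continuous_subspaceT; exact: quot_proj_continuous.
by apply/seteqP; split=> // q _; have [x <-] := quot_proj_surj q; exists x.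
Qed.

Lemma mapping_cone_compact (R : realType) (Y X : topologicalType) (f : Y -> X) :
  compact [set: Y] -> compact [set: X] -> compact [set: mapping_cone R f].
Proof.
move=> cY cX; apply: quot_space_compact; apply: sigT_compact => [|[]] //=.
  rewrite -setXTT; apply: compact_setX => //; apply: compact_set_type.
  exact: segment_compact.
Qed.

(* [f0] and [F] are the restrictions to [X] and to the cylinder. *)
Lemma mapping_cone_lift (R : realType) (Y X Z : topologicalType) (f : Y -> X)
    (f0 : X -> Z) (F : Y * set_type `[0%R, 1%R : R]%classic -> Z) :
  continuous f0 -> continuous F ->
  (forall y s, set_val s = 0 -> F (y, s) = f0 (f y)) ->
  (forall y y' s s', set_val s = 1 -> set_val s' = 1 -> F (y, s) = F (y', s')) ->
  exists2 h : mapping_cone R f -> Z, continuous h &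
    (forall x, h (cone_base R f x) = f0 x) /\
    (forall y s, h (quot_proj (cone_rel f) (cyl_pt X y s)) = F (y, s)).
Proof.
move=> f0c Fc F0 F1.
pose g (c : bool) : cone_summand R Y X c -> Z :=
  match c return cone_summand R Y X c -> Z with true => F | false => f0 end.
pose G (u : {c & cone_summand R Y X c}) := g (projT1 u) (projT2 u).
have gc : continuous G by apply: (@sigT_continuous _ _ _ g) => -[].
have gr u v : cone_rel f u v -> G u = G v.
  by case=> [y s s0|y y' s s' s1 s'1]; [exact: F0|exact: F1].
have [h hc hE] := quot_lift gr gc.
by exists h => //; split=> [x|y s]; rewrite hE.
Qed.

(** * Orbit spaces *)

Section Orbits.
Variables (R : realType) (m : nat) (b : 'I_m.+1 -> nat).
Local Notation C := (Cplx R).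
Local Notation V := 'rV[Cplx R]_m.+1.

Lemma cvg_wact (T : Type) (F : set_system T) {FF : Filter F} (t : T -> C)
    (z : T -> V) (t0 : C) (z0 : V) :
  t @ F --> t0 -> z @ F --> z0 -> wact b (t x) (z x) @[x --> F] --> wact b t0 z0.
Proof.
move=> tt zz; apply: cvg_mx => i j; rewrite mxE; under eq_fun do rewrite mxE.
by apply: cvgM; [exact: cvg_exprn|exact: cvg_coord].
Qed.

Lemma wact_continuous t : continuous (wact b t : V -> V).
Proof.
move=> z; apply: (@cvg_wact V (nbhs z) _ (fun=> t) id t z); last exact: cvg_id.
exact: cvg_cst.
Qed.

Variables (G : set C) (S : set V).
Hypothesis G1 : G 1.
Hypothesis GM : forall s t, G s -> G t -> G (s * t).
Hypothesis GV : forall t, G t -> t != 0 /\ G t^-1.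
Hypothesis GS : forall t z, G t -> S z -> S (wact b t z).

Lemma orbit_rel_equiv : equivalence _ (@orbit_rel R m b G S).
Proof.
split=> [x|x y z [t Gt yE] [s Gs zE]|x y [t Gt yE]]; rewrite /orbit_rel.
- by exists 1; rewrite ?wact1.
- by exists (s * t); [exact: GM|rewrite zE yE wactM].
- by have [t0 GVt] := GV Gt; exists t^-1; rewrite ?yE ?wactK.
Qed.

Lemma orbit_projP (x y : set_type S) :
  quot_proj (@orbit_rel R m b G S) x = quot_proj (@orbit_rel R m b G S) y <->
  exists2 t, G t & set_val y = wact b t (set_val x).
Proof. exact: (quot_proj_equiv orbit_rel_equiv). Qed.

Lemma orbit_proj_open (U : set (set_type S)) : open U ->
  open (quot_proj (@orbit_rel R m b G S) @` U).
Proof.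
(* The subset is stable only under [G], hence the dummy value [x] for other scalars. *)
pose a t (x : set_type S) : set_type S :=
  if pselect (G t) is left tG then set_elt (GS tG (set_val_in x)) else x.
have aE t x : G t -> set_val (a t x) = wact b t (set_val x).
  by move=> Gt; rewrite /a; case: pselect.
apply: (quot_proj_open orbit_rel_equiv (D := G) (a := a)) => [t Gt|x y].
  apply: continuous_set_type; under eq_fun do rewrite (aE _ _ Gt).
  move=> x; exact: (cvg_comp _ _ (@set_val_continuous V S x)
    (@wact_continuous t (set_val x))).
split=> -[t Gt e]; exists t => //; last by rewrite e aE.
by apply: set_val_inj; rewrite e aE.
Qed.

End Orbits.

(** * Separation of orbits *)

Section Separation.
Variables (R : realType) (m : nat) (b : 'I_m.+1 -> nat).
Hypothesis b1 : forall i, (1 <= b i)%N.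
Local Notation C := (Cplx R).
Local Notation V := 'rV[Cplx R]_m.+1.

Lemma wact_norm_ge (t : C) (z : V) : 1 <= `|t| -> `|t| * `|z| <= `|wact b t z|.
Proof.
move=> t1; have t0 : 0 < `|t| by exact: lt_le_trans t1.
have tV : `|t^-1| <= 1 by rewrite normfV invf_le1.
have := wact_norm_le b1 (wact b t z) tV.
by rewrite wactK ?normfV 1?mulrC ?ler_pdivlMr// 1?mulrC// -normr_gt0.
Qed.

(** The acting group is not compact. Scalars with [|t| <= 2] form a compact set, over which a tube
    argument gives uniform neighbourhoods. For [|t| >= 2] norms suffice: the radii [1/4] and [1/2]
    give [|t z'| > 2 * 3/4 = 3/2 > |w'|]. *)
Lemma wact_separated (z w : V) : `|z| = 1 -> `|w| = 1 ->
  (forall t, t != 0 -> w <> wact b t z) ->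
  exists A B : set V, [/\ open_nbhs z A, open_nbhs w B &
    forall z' w' t, A z' -> B w' -> t != 0 -> w' <> wact b t z'].
Proof.
move=> z1 w1 zw; pose K := [set t : C | `|t| <= 2].
have Kc : compact K.
  have := @complex_disc_compact R 2 (ler0n _ 2); rewrite (_ : real_complex R 2 = 2)//.
  by rewrite rmorph_nat.
(* The compact disc contains [t = 0]; there all weights being positive sends [z] to 0, which is not
   the unit vector [w]. *)
have nzw t : w - wact b t z != 0.
  rewrite subr_eq0; apply/eqP; have [->|/zw//] := eqVneq t 0.
  move=> w0; have : `|w| = 0.
    rewrite w0; apply/eqP; rewrite normr_eq0; apply/eqP/rowP => i.
    by rewrite wactE mxE expr0n gtn_eqF ?b1// mul0r.
  by rewrite w1 => /eqP; rewrite oner_eq0.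
have H : \forall zw' \near nbhs ((z, w) : V * V),
    K `<=` (fun t => zw'.2 <> wact b t zw'.1).
  move/compact_near_coveringP: Kc; apply => t _.
  pose g (x : C * (V * V)) := x.2.2 - wact b x.1 x.2.1.
  have gc : g @ nbhs ((t, (z, w)) : C * (V * V)) --> w - wact b t z.
    have c2 : x.2 @[x --> ((t, (z, w)) : C * (V * V))] --> ((z, w) : V * V) by exact: cvg_snd.
    have c3 : y.2 @[y --> ((z, w) : V * V)] --> w by exact: cvg_snd.
    have c4 : y.1 @[y --> ((z, w) : V * V)] --> z by exact: cvg_fst.
    apply: cvgB; first exact: (cvg_comp _ _ c2 c3).
    by apply: cvg_wact; [exact: cvg_fst|exact: (cvg_comp _ _ c2 c4)].
  have nO : nbhs (w - wact b t z) [set v : V | v != 0].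
    apply: open_nbhs_nbhs; split; last exact: nzw.
    rewrite (_ : [set _ | _] = ~` [set 0]); last first.
      by apply/seteqP; split=> x /= /eqP.
    apply: closed_openC; apply: compact_closed; last exact: compact_set1.
    exact: norm_hausdorff.
  apply: (@filterS _ (nbhs ((t, (z, w)) : C * (V * V))) _ _ _ _ (gc _ nO)).
  move=> -[t' [z' w']] /= gx e; move: gx.
  by rewrite /g /= e subrr eqxx.
move: H => [[A B] /= [nA nB] AB].
have half0 : 0 < 2^-1 :> C by rewrite invr_gt0.
have q0 : 0 < 4^-1 :> C by rewrite invr_gt0.
have nz : \forall z' \near z, `|z - z'| < 4^-1.
  by have /cvgrPdist_lt/(_ _ q0) : id x @[x --> z] --> z by exact: cvg_id.
have nw : \forall w' \near w, `|w - w'| < 2^-1.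
  by have /cvgrPdist_lt/(_ _ half0) : id x @[x --> w] --> w by exact: cvg_id.
have : nbhs z (A `&` [set z' | `|z - z'| < 4^-1]) by exact: filterI nA nz.
rewrite nbhsE => -[A' oA' A'A].
have : nbhs w (B `&` [set w' | `|w - w'| < 2^-1]) by exact: filterI nB nw.
rewrite nbhsE => -[B' oB' B'B].
exists A', B'; split=> // z' w' t /A'A[Az' zz'] /B'B[Bw' ww'] t0 e.
have [tK|tK] : `|t| <= 2 \/ 2 <= `|t|.
- by apply/orP; rewrite real_leVge ?normr_real// realn.
- exact: (AB (z', w') _ t tK).
have z'3 : 1 - 4^-1 < `|z'|.
  have := ler_normD (z - z') z'; rewrite subrK z1 ltrBlDr => /le_lt_trans; apply.
  by rewrite addrC ltrD2l.
have w'3 : `|w'| < 1 + 2^-1.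
  have := ler_normD (w' - w) w; rewrite subrK w1 => /le_lt_trans; apply.
  by rewrite addrC ltrD2l distrC.
have : 2 * (1 - 4^-1) < 1 + 2^-1 :> C.
  apply: lt_trans w'3; apply: (@lt_le_trans _ _ (2 * `|z'|)).
    by rewrite ltr_pM2l.
  rewrite e; apply: le_trans (wact_norm_ge _ _); last by apply: le_trans tK; rewrite ler1n.
  by rewrite ler_wpM2r.
by rewrite (_ : 2 * (1 - 4^-1) = 1 + 2^-1) ?ltxx//; field.
Qed.

End Separation.

(** * Continuity of the cell maps and compactness of their domains *)

Section FrameLimits.
Variables (C : numClosedFieldType) (T : Type) (F : set_system T).
Context {FF : Filter F}.
Variables (k n : nat) (u : T -> 'M[C]_(k, n)) (u0 : 'M[C]_(k, n)).
Hypothesis uu0 : u @ F --> u0.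

Lemma cvg_tri : tri (u x) @[x --> F] --> tri u0.
Proof.
apply: cvg_mx => r s; rewrite mxE; under eq_fun do rewrite mxE.
case: ifP => _.
  apply: (@cvgB C C^o); first exact: cvg_cst.
  apply: cvg_norm; apply: cvg_mx => a c.
  by rewrite mxE; under eq_fun do rewrite mxE; exact: cvg_coord.
case: ifP => _; last exact: cvg_cst.
apply: (@cvgN C C^o); rewrite gramE; under eq_fun do rewrite gramE.
by apply: cvg_bigsum => c; apply: cvgM; [|apply: cvg_conj]; exact: cvg_coord.
Qed.

Lemma cvg_frame (l : schubert k n) : frame l (u x) @[x --> F] --> frame l u0.
Proof.
by apply: cvgD => //; apply: cvg_mulmx; [exact: cvg_tri|exact: cvg_cst].
Qed.

Lemma cvg_minor (g : 'I_k -> 'I_n) : minor (u x) g @[x --> F] --> minor u0 g.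
Proof.
apply: cvg_det; apply: cvg_mx => r q; rewrite mxE; under eq_fun do rewrite mxE.
exact: cvg_coord.
Qed.

End FrameLimits.

Section CellTopology.
Variables (R : realType) (k n m : nat) (lam : 'I_m.+1 -> schubert k n).
Local Notation C := (Cplx R).
Local Notation V := 'rV[Cplx R]_m.+1.

Section Limits.
Variables (T : Type) (F : set_system T) (f : T -> V) (y : V).
Context {FF : Filter F}.
Hypothesis fy : f @ F --> y.

Lemma cvg_coordmx p : coordmx lam p (f x) @[x --> F] --> coordmx lam p y.
Proof.
apply: cvg_mx => r c; rewrite mxE; under eq_fun do rewrite mxE.
by case: ifP => _; [exact: cvg_coord|exact: cvg_cst].
Qed.

Lemma cvg_cell_vec p : cell_vec lam p (f x) @[x --> F] --> cell_vec lam p y.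
Proof.
apply: cvg_mx => i j; rewrite [cell_vec _ _ _ _ _]mxE.
under eq_fun do rewrite [cell_vec _ _ _ _ _]mxE.
by apply: cvg_minor; apply: cvg_frame; exact: cvg_coordmx.
Qed.

Hypothesis hlam : schubert_order lam.

Lemma cvg_cell_map p : cell_disc lam p y ->
  cell_map lam p (f x) @[x --> F] --> cell_map lam p y.
Proof.
move=> yD; apply: cvgZ; last exact: cvg_cell_vec.
apply: (@cvgV C); first by rewrite normr_eq0 cell_vec_neq0.
by apply: cvg_norm; exact: cvg_cell_vec.
Qed.

End Limits.

Hypothesis hlam : schubert_order lam.

Lemma cell_disc_compact p : compact (cell_disc lam p : set V).
Proof.
pose K (j : 'I_m.+1) : set C :=
  if `[<raised (lam p) (lam j)>] then [set x : C | `|x| <= 1] else [set 0].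
have Kc j : compact (K j).
  rewrite /K; case: ifP => _; last exact: compact_set1.
  have := @complex_disc_compact R 1 ler01; rewrite (_ : real_complex R 1 = 1)//.
have := rV_compact Kc; congr compact; apply/seteqP; split=> y /=.
  move=> yK; split=> [j nr|].
    by have := yK j; rewrite /K asboolF.
  apply: mx_norm_le => // i j; rewrite ord1; have := yK j; rewrite /K.
  by case: ifP => // _ ->; rewrite normr0.
move=> [yE y1] j; rewrite /K; case: asboolP => [_|/yE//].
exact: le_trans (le_entry_mx_norm _ _ _) y1.
Qed.

Lemma raised_sphere_disc p (y : V) : raised_sphere R lam p y -> cell_disc lam p y.
Proof.
move=> [yE y1]; split=> //; apply: mx_norm_le => // i j; rewrite ord1.
rewrite -(@expr_le1 _ 2)//.
by have <- := y1; rewrite (bigD1 j)//= lerDl sumr_ge0.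
Qed.

Lemma raised_sphere_compact p : compact (raised_sphere R lam p : set V).
Proof.
rewrite (_ : raised_sphere R lam p = cell_disc lam p `&`
    [set y : V | \sum_j `|y 0 j| ^+ 2 = 1]); last first.
  apply/seteqP; split=> y; last by move=> [[yE _] y1].
  by move=> yS; split; [exact: raised_sphere_disc|case: yS].
apply: compact_closedI; first exact: cell_disc_compact.
apply: (@closed_comp _ _ (fun y : V => \sum_j `|y 0 j| ^+ 2) [set 1]).
  have sq (T : Type) (F : set_system T) (FF : Filter F) (f : T -> V) (y : V) :
      f @ F --> y -> (\sum_j `|f x 0 j| ^+ 2) @[x --> F] --> \sum_j `|y 0 j| ^+ 2.
    move=> fy; apply: cvg_bigsum => j; apply: cvg_exprn.
    by apply: (@cvg_norm C C^o); exact: cvg_coord.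
  by move=> y _; exact: (sq V (nbhs y) _ id y cvg_id).
by apply: compact_closed; [exact: (@norm_hausdorff C C^o)|exact: compact_set1].
Qed.

Lemma raised_sphere_norm p (y : V) : raised_sphere R lam p y -> 0 < `|y|.
Proof.
move=> [_ y1]; rewrite normr_gt0; apply/eqP => y0.
move: y1; rewrite y0 big1 => [/eqP|j _]; first by rewrite eq_sym oner_eq0.
by rewrite mxE normr0 expr0n.
Qed.

End CellTopology.

(** * Skeleta *)

Lemma wactZ (R : realType) m (b : 'I_m.+1 -> nat) (t a : Cplx R) z :
  wact b t (a *: z) = a *: wact b t z.
Proof. by apply/rowP => i; rewrite !mxE mulrCA. Qed.

Section GrTopology.
Variables (R : realType) (k n m : nat) (lam : 'I_m.+1 -> schubert k n).
Hypotheses (k0 : (0 < k)%N) (kn : (k < n)%N).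
Hypothesis hlam : schubert_order lam.
Variable b : 'I_m.+1 -> nat.
Hypothesis hb : plucker_weight lam b.
Local Notation C := (Cplx R).
Local Notation V := 'rV[Cplx R]_m.+1.

Let b1 : forall i, (1 <= b i)%N := hb.1.

Let unit_mul (s t : C) : s != 0 -> t != 0 -> s * t != 0 := @mulf_neq0 _ s t.

Let unit_inv (t : C) : t != 0 -> t != 0 /\ t^-1 != 0.
Proof. by move=> t0; rewrite invr_eq0. Qed.

Lemma Gr_projP (x y : set_type (Pl R lam)) :
  Gr_proj lam b x = Gr_proj lam b y <->
  exists2 t : C, t != 0 & set_val y = wact b t (set_val x).
Proof.
exact: (@orbit_projP R m b [set t : C | t != 0] (Pl R lam) (oner_neq0 C) (@unit_mul) (@unit_inv)).
Qed.

Lemma Gr_proj_open (U : set (set_type (Pl R lam))) :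
  open U -> open (Gr_proj lam b @` U).
Proof.
apply: (@orbit_proj_open R m b [set t : C | t != 0] (Pl R lam) (oner_neq0 C) (@unit_mul) (@unit_inv)).
by move=> t z t0; exact: wact_Pl.
Qed.

Lemma Gr_proj_surj (q : Gr R lam b) : exists x, Gr_proj lam b x = q.
Proof. exact: quot_proj_surj. Qed.

Lemma Gr_proj_continuous : continuous (@Gr_proj R k n m lam b).
Proof. exact: quot_proj_continuous. Qed.

Lemma Pl_neq0 (x : set_type (Pl R lam)) : set_val x != 0.
Proof. by have [] := set_val_in x. Qed.

Lemma Gr_proj_normalized (q : Gr R lam b) :
  exists x, Gr_proj lam b x = q /\ `|set_val x : V| = 1.
Proof.
have [x <-] := Gr_proj_surj q.
have [s s0 sx] := wact_normalize b1 (Pl_neq0 x).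
have s0' : s != 0 by rewrite gt_eqF.
exists (set_elt (wact_Pl k0 kn hlam hb s0' (set_val_in x))); split=> //.
by apply/esym/Gr_projP; exists s.
Qed.

(** Unit representatives of distinct points have neighbourhoods that no scalar brings together, and
    the projection is open. *)
Lemma Gr_hausdorff : hausdorff_space (Gr R lam b).
Proof.
move=> p q pq; have [x [xp x1]] := Gr_proj_normalized p.
have [y [yq y1]] := Gr_proj_normalized q.
apply: contrapT => npq.
have [|A [B [[oA Ax] [oB By] AB]]] := wact_separated b1 x1 y1.
  by move=> t t0 e; apply: npq; rewrite -xp -yq; apply/Gr_projP; exists t.
have sat (D : set V) (oD : open D) z : D (set_val z) ->
    nbhs (Gr_proj lam b z) (Gr_proj lam b @` (set_val @^-1` D)).
  move=> Dz; apply: open_nbhs_nbhs; split; last by exists z.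
  by apply: Gr_proj_open; exists D.
have := pq _ _; rewrite -xp -yq => /(_ _ _ (sat _ oA _ Ax) (sat _ oB _ By)).
move=> [_ [[z Az <-] [w Bw /Gr_projP[t t0 e]]]].
by apply: (AB _ _ t^-1 Az Bw); rewrite ?invr_eq0// e wactK.
Qed.

(** A vector lies in the cell of its first nonzero coordinate, and the action preserves the
    vanishing of coordinates. *)
Lemma skeletonP d (x : set_type (Pl R lam)) : skeleton R lam b d (Gr_proj lam b x) <->
  forall j : 'I_m.+1, (j < m - d)%N -> set_val x 0 j = 0.
Proof.
split=> [[j /= dj [y [yj ylt] /Gr_projP[t t0 ->]]] a ad|H].
  by rewrite wactE ylt ?mulr0// (leq_trans ad).
have [j0 xj0] : exists j, set_val x 0 j != 0.
  apply: contrapT => N; move: (Pl_neq0 x); apply/negP; rewrite negbK.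
  apply/eqP/rowP => j; rewrite mxE; apply: contrapT => /eqP xj.
  by apply: N; exists j.
case: (@arg_minnP _ j0 (fun j => set_val x 0 j != 0) (@nat_of_ord _) xj0) => j xj jmin.
exists j; last first.
  exists x => //; split=> // a aj; apply: contrapT => /eqP /jmin.
  by rewrite leqNgt aj.
by rewrite /= leqNgt; apply/negP => /H e; rewrite e eqxx in xj.
Qed.

Definition cell_pt p (y : set_type (cell_disc lam p : set V)) : set_type (Pl R lam) :=
  set_elt (cell_map_Pl k0 hlam (set_val_in y)).

Lemma cell_pt_continuous p : continuous (@cell_pt p).
Proof.
apply: continuous_set_type => y.
exact: (@cvg_cell_map _ _ _ _ _ (set_type (cell_disc lam p : set V)) (nbhs y) set_val
  (set_val y) _ (@set_val_continuous _ _ y) hlam p (set_val_in y)).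
Qed.

Lemma cell_cover (p : 'I_m.+1) (x : set_type (Pl R lam)) :
  (forall j : 'I_m.+1, (j < p)%N -> set_val x 0 j = 0) -> set_val x 0 p != 0 ->
  exists y, `|set_val y : V| < 1 /\ Gr_proj lam b (@cell_pt p y) = Gr_proj lam b x.
Proof.
move=> xlt xp; have [t [t0 tx1 txp]] := wact_normalize_pos b1 xp.
have tP := wact_Pl k0 kn hlam hb t0 (set_val_in x).
have tlt (j : 'I_m.+1) : (j < p)%N -> wact b t (set_val x) 0 j = 0.
  by move=> /xlt e; rewrite wactE e mulr0.
have [y [yD y1 ytx]] := cell_map_surj hlam tP tx1 tlt txp.
exists (set_elt yD); split=> //; apply/esym/Gr_projP; exists t => //.
Qed.

(** A finite union of images of closed discs: the open discs already cover the cells, and the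
    boundaries stay in the skeleton since the coordinates before [p] vanish on the whole closed
    disc. *)
Lemma skeleton_compact d : compact (skeleton R lam b d).
Proof.
rewrite (_ : skeleton R lam b d = \bigcup_(p in [set p : 'I_m.+1 | (m - d <= p)%N])
    ((fun y => Gr_proj lam b (@cell_pt p y)) @` setT)); last first.
  apply/seteqP; split=> [_ [p dp [x [xp xlt] <-]]|_ [p dp [y _ <-]]].
    by have [y [_ <-]] := cell_cover xlt xp; exists p => //; exists y.
  apply/skeletonP => j jd; apply: (cell_map_lt hlam); first exact: set_val_in.
  exact: leq_trans jd dp.
rewrite (_ : \bigcup_(p in _) _ = \big[setU/set0]_(p <- index_enum 'I_m.+1 | (m - d <= p)%N)
    ((fun y => Gr_proj lam b (@cell_pt p y)) @` setT)); last first.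
  rewrite -bigcup_seq_cond; congr bigcup; apply/seteqP; split=> p /=.
    by move=> ->; rewrite mem_index_enum.
  by case/andP.
apply: bigsetU_compact => p _; apply: continuous_compact; last first.
  by apply: compact_set_type; exact: cell_disc_compact.
apply: continuous_subspaceT => y.
exact: (cvg_comp _ _ (@cell_pt_continuous p y) (@Gr_proj_continuous _)).
Qed.

End GrTopology.

(** * Attaching a cell *)

Section CellAttachment.
Variables (R : realType) (k n m : nat) (lam : 'I_m.+1 -> schubert k n).
Hypotheses (k0 : (0 < k)%N) (kn : (k < n)%N).
Hypothesis hlam : schubert_order lam.
Variable b : 'I_m.+1 -> nat.
Hypothesis hb : plucker_weight lam b.
Local Notation C := (Cplx R).
Local Notation V := 'rV[Cplx R]_m.+1.
Local Notation I01 := (set_type `[0%R, 1%R : R]%classic).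
Local Notation toC := (real_complex R : R -> Cplx R).

Let b1 : forall i, (1 <= b i)%N := hb.1.

Variables (p : 'I_m.+1) (pm : (p < m)%N).
Local Notation S := (raised_sphere R lam p : set V).
Local Notation Gp := [set t : C | t != 0 /\ t ^+ b p = 1].
Local Notation lens_proj := (quot_proj (@orbit_rel R m b Gp S)).

Lemma root_norm (t : C) : t ^+ b p = 1 -> `|t| = 1.
Proof.
move=> tb; apply: (@pexpIrn _ (b p)); rewrite ?nnegrE ?normr_ge0 ?ler01 ?b1//.
by rewrite -normrX tb normr1 expr1n.
Qed.

Lemma pos_phase (t x x' : C) e : `|t| = 1 -> 0 < x -> 0 < x' -> x' = t ^+ e * x ->
  t ^+ e = 1.
Proof.
move=> t1 x0 x0' xE; apply: (mulIf (lt0r_neq0 x0)); rewrite mul1r -xE.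
by rewrite -[LHS](gtr0_norm x0') xE normrM normrX t1 expr1n mul1r gtr0_norm.
Qed.

Let G1 : Gp 1.
Proof. by split; [exact: oner_neq0|rewrite expr1n]. Qed.

Let GM (s t : C) : Gp s -> Gp t -> Gp (s * t).
Proof. by move=> [s0 sb] [t0 tb]; split; [exact: mulf_neq0|rewrite exprMn sb tb mulr1]. Qed.

Let GV (t : C) : Gp t -> t != 0 /\ Gp t^-1.
Proof. by move=> [t0 tb]; do ?split=> //; rewrite ?invr_eq0// exprVn tb invr1. Qed.

Let GS (t : C) (z : V) : Gp t -> S z -> S (wact b t z).
Proof.
move=> [t0 /root_norm t1] [zE z1]; split=> [j /zE e|]; first by rewrite wactE e mulr0.
by rewrite -z1; apply: eq_bigr => j _; rewrite wactE normrM normrX t1 expr1n mul1r.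
Qed.

Lemma lens_projP (x y : set_type S) : lens_proj x = lens_proj y <->
  exists2 t : C, Gp t & set_val y = wact b t (set_val x).
Proof. exact: (@orbit_projP R m b Gp S G1 (@GM) (@GV)). Qed.

Lemma lens_proj_open (U : set (set_type S)) : open U -> open (lens_proj @` U).
Proof. exact: (@orbit_proj_open R m b Gp S G1 (@GM) (@GV) (@GS)). Qed.

(** Fails only for the top symbol, excluded by [p < m]. Without such a point the cylinder would be
    empty and the centre of the cell would be missed. *)
Lemma raised_sphere_ex : exists y : V, S y.
Proof.
have [j rj] : exists j, raised (lam p) (lam j).
  apply: contrapT => N; have : (m <= p)%N; last by rewrite leqNgt pm.
  apply: (lam_le (i := ord_max) hlam); apply: schubert_le_not_raised => r c cl.
  rewrite ltn_neqAle; apply/andP; split.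
    by apply: contra cl => /eqP/val_inj ->; exact: sentry_sset.
  rewrite leqNgt; apply/negP => rc; apply: N; exists (swap_idx lam p r c).
  by apply: swap_idx_raised => //; apply/andP.
exists (delta_mx 0 j); split.
  move=> a nr; rewrite mxE eqxx /=; case: eqP => // e.
  by case: nr; rewrite e.
rewrite (bigD1 j)//= mxE !eqxx normr1 expr1n big1 ?addr0// => a aj.
by rewrite mxE (negbTE aj) andbF normr0 expr0n.
Qed.

(** Polar coordinates on the polydisc, with directions taken from the Euclidean sphere and radius
    [1 - s] in the sup norm: [s = 0] is the boundary, to be glued, and [s = 1] is the centre, the
    tip of the cone. *)
Definition scal (y : V) (s : R) : V := ((1 - toC s) / `|y|) *: y.

Lemma cvg_scal (T : Type) (F : set_system T) {FF : Filter F} (f : T -> V) (y : V)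
    (s : T -> R) (s0 : R) : y != 0 -> f @ F --> y -> s @ F --> s0 ->
  scal (f x) (s x) @[x --> F] --> scal y s0.
Proof.
move=> y0 fy ss; apply: cvgZ => //; apply: cvgM; last first.
  by apply: (@cvgV C); [rewrite normr_eq0|exact: cvg_norm].
apply: (@cvgB C C^o); first exact: cvg_cst.
exact: (cvg_comp _ _ ss (@real_complex_continuous R s0)).
Qed.

Lemma scal_norm y (s : R) : y != 0 -> s <= 1 -> `|scal y s| = 1 - toC s.
Proof.
move=> y0 s1; rewrite normrZ normrM normfV normr_id mulfVK ?normr_eq0//.
by rewrite ger0_norm// subr_ge0 -(rmorph1 toC) lecR.
Qed.

Lemma scal_disc y (s : R) : S y -> 0 <= s <= 1 -> cell_disc lam p (scal y s).
Proof.
move=> yS /andP[s0 s1]; have y0 : y != 0 by rewrite -normr_gt0 (raised_sphere_norm yS).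
split; last by rewrite scal_norm// gerBl -(rmorph0 toC) lecR.
by move=> j nr; rewrite mxE yS.1// mulr0.
Qed.

Lemma I01P (s : I01) : 0 <= set_val s <= 1.
Proof. by have := set_val_in s; rewrite /= in_itv. Qed.

Definition cyl_disc (ys : set_type S * I01) : set_type (cell_disc lam p : set V) :=
  set_elt (scal_disc (set_val_in ys.1) (I01P ys.2)).

Lemma cyl_disc_continuous : continuous cyl_disc.
Proof.
apply: continuous_set_type => -[y s].
have cf : ys.1 @[ys --> ((y, s) : set_type S * I01)] --> y by exact: cvg_fst.
have cs : ys.2 @[ys --> ((y, s) : set_type S * I01)] --> s by exact: cvg_snd.
have c1 : (set_val ys.1 : V) @[ys --> ((y, s) : set_type S * I01)] --> (set_val y : V).
  exact: (cvg_comp _ _ cf (@set_val_continuous _ _ y)).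
have c2 : (set_val ys.2 : R) @[ys --> ((y, s) : set_type S * I01)] --> (set_val s : R).
  exact: (cvg_comp _ _ cs (@set_val_continuous _ _ s)).
have y0 : set_val y != 0 by rewrite -normr_gt0 (raised_sphere_norm (set_val_in y)).
exact: (cvg_scal y0 c1 c2).
Qed.

Definition cyl_Gr (ys : set_type S * I01) : Gr R lam b :=
  Gr_proj lam b (cell_pt k0 hlam (cyl_disc ys)).

Lemma cyl_GrP y s y' s' : cyl_Gr (y, s) = cyl_Gr (y', s') <-> exists2 t : C, t != 0 &
  cell_map lam p (scal (set_val y') (set_val s')) =
  wact b t (cell_map lam p (scal (set_val y) (set_val s))).
Proof. exact: Gr_projP. Qed.

Lemma cyl_GrE y s x : Gr_proj lam b x = cyl_Gr (y, s) <-> exists2 t : C, t != 0 &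
  cell_map lam p (scal (set_val y) (set_val s)) = wact b t (set_val x).
Proof. exact: Gr_projP. Qed.

Lemma cyl_Gr_continuous : continuous cyl_Gr.
Proof.
move=> ys; have c1 := @cyl_disc_continuous ys.
have c2 := @cell_pt_continuous R k n m lam k0 hlam p (cyl_disc ys).
have c3 := @Gr_proj_continuous R k n m lam b (cell_pt k0 hlam (cyl_disc ys)).
exact: (cvg_comp _ _ (cvg_comp _ _ c1 c2) c3).
Qed.

Lemma cyl_Gr_orbit y y' s : lens_proj y = lens_proj y' -> cyl_Gr (y, s) = cyl_Gr (y', s).
Proof.
move=> /lens_projP[t [t0 tb] e]; apply/cyl_GrP; exists t => //.
have t1 := root_norm tb; have H := @cell_map_wact R k n m lam k0 kn hlam b hb p t.
rewrite -(H _ t1 tb); congr (cell_map _ _ _).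
by rewrite /scal e wactZ wact_norm.
Qed.

Lemma cyl_Gr_skeleton ys : skeleton R lam b (m - p) (cyl_Gr ys).
Proof.
apply/skeletonP => j; rewrite subKn ?(ltnW pm)// => jp.
exact: (cell_map_lt hlam (set_val_in (cyl_disc ys)) jp).
Qed.

Lemma cyl_Gr_boundary y s : set_val s = 0 -> skeleton R lam b (m - p).-1 (cyl_Gr (y, s)).
Proof.
move=> s0; have yS := set_val_in y.
have y0 : set_val y != 0 by rewrite -normr_gt0 (raised_sphere_norm yS).
have yD := scal_disc yS (I01P s).
(* One dimension less means that coordinate [p] must vanish too, besides those before it. *)
apply/skeletonP => j; rewrite -subnS subKn// ltnS.
rewrite leq_eqVlt => /orP[/eqP/val_inj ->|jp]; last exact: (cell_map_lt hlam yD jp).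
apply: (cell_map_boundary hlam yD).
by rewrite scal_norm// s0 ?ler01// rmorph0 subr0.
Qed.

Lemma cyl_Gr_inner y s x : 0 < (set_val s : R) -> Gr_proj lam b x = cyl_Gr (y, s) ->
  set_val x 0 p != 0.
Proof.
move=> s0 /cyl_GrE[t t0 e].
have yS := set_val_in y; have /andP[_ s1] := I01P s.
have y0 : set_val y != 0 by rewrite -normr_gt0 (raised_sphere_norm yS).
rewrite -(wact_eq0 b _ _ t0) -e gt_eqF// (cell_map_pos hlam)//.
  exact: (scal_disc yS (I01P s)).
by rewrite scal_norm// gtrBl -(rmorph0 toC) ltcR.
Qed.

Lemma cyl_Gr_cover (x : set_type (Pl R lam)) :
  (forall j : 'I_m.+1, (j < p)%N -> set_val x 0 j = 0) -> set_val x 0 p != 0 ->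
  exists ys, cyl_Gr ys = Gr_proj lam b x.
Proof.
move=> xlt xp; have [y [y1 <-]] := cell_cover k0 kn hlam hb xlt xp.
suff [ys e] : exists ys : set_type S * I01, scal (set_val ys.1) (set_val ys.2) = set_val y :> V.
  by exists ys; rewrite /cyl_Gr; congr (Gr_proj _ _ (cell_pt _ _ _)); exact: set_val_inj.
have [yE _] := set_val_in y; move: (set_val y : V) y1 yE => {}y y1 yE.
have [y0|y0] := eqVneq y 0.
  have [z zS] := raised_sphere_ex.
  have I1 : `[0%R, 1%R : R]%classic 1 by rewrite /= in_itv /= ler01 lexx.
  exists (set_elt zS, set_elt I1) => /=.
  by rewrite /scal rmorph1 subrr mul0r scale0r y0.
(* Off the centre, the direction is [y] divided by its Euclidean norm and the height is [1 - |y|] in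
   the sup norm. *)
pose N : C := \sum_j `|y 0 j| ^+ 2.
have N0 : 0 < N.
  have [i [j]] := mx_norm_attained y0; rewrite ord1 => yj.
  rewrite /N (bigD1 j)//= ltr_pwDl ?exprn_gt0 -?yj ?normr_gt0//.
  by apply: sumr_ge0 => a _; rewrite exprn_ge0.
pose g := sqrtC N; have g0 : 0 < g by rewrite sqrtC_gt0.
have zS : S (g^-1 *: y).
  split=> [j /yE e|]; first by rewrite mxE e mulr0.
  under eq_bigr do rewrite mxE normrM exprMn.
  rewrite -mulr_sumr -/N normfV gtr0_norm// exprVn sqrtCK mulVf//.
  by rewrite gt_eqF.
pose s : R := complex.Re (1 - `|y|).
have sE : toC s = 1 - `|y|.
  by apply: complex.RRe_real; rewrite rpredB ?realn ?rpred1 ?normr_real.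
have I1 : `[0%R, 1%R : R]%classic s.
  rewrite /= in_itv /= -(complex.lecR 0 s) -(complex.lecR s 1) -/(toC s) sE.
  by rewrite subr_ge0 (ltW y1) gerBl normr_ge0.
exists (set_elt zS, set_elt I1) => /=.
rewrite /scal sE subKr normrZ normfV gtr0_norm// scalerA.
rewrite -[RHS]scale1r; congr (_ *: _); field.
by rewrite normr_eq0 y0 gt_eqF.
Qed.

(** Unit norm forces [|t| = 1], and positivity of both [p]-th coordinates forces [t ^+ b p = 1].
    Then [t] can be moved inside the cell map, whose injectivity relates the two points of the open
    disc by [t]; norms give equal heights. *)
Lemma cyl_Gr_inj y s y' s' : 0 < (set_val s : R) -> 0 < (set_val s' : R) ->
  cyl_Gr (y, s) = cyl_Gr (y', s') ->
  s = s' /\ (set_val s = 1 \/ lens_proj y = lens_proj y').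
Proof.
move=> s0 s0' /cyl_GrP[t t0 e].
have yS := set_val_in y; have yS' := set_val_in y'.
have yD := scal_disc yS (I01P s); have yD' := scal_disc yS' (I01P s').
have /andP[_ s1] := I01P s; have /andP[_ s1'] := I01P s'.
have y0 := raised_sphere_norm yS; have y0' := raised_sphere_norm yS'.
have N : `|scal (set_val y) (set_val s)| = 1 - toC (set_val s).
  by rewrite scal_norm// -normr_gt0.
have N' : `|scal (set_val y') (set_val s')| = 1 - toC (set_val s').
  by rewrite scal_norm// -normr_gt0.
have lt1 : `|scal (set_val y) (set_val s)| < 1.
  by rewrite N gtrBl -(rmorph0 toC) complex.ltcR.
have lt1' : `|scal (set_val y') (set_val s')| < 1.
  by rewrite N' gtrBl -(rmorph0 toC) complex.ltcR.
have t1 : `|t| = 1.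
  by apply: (wact_norm_eq1 b1 t0 (cell_map_norm hlam yD)); rewrite -e (cell_map_norm hlam yD').
have tb : t ^+ b p = 1.
  apply: (pos_phase t1 (cell_map_pos hlam yD lt1) (cell_map_pos hlam yD' lt1')).
  by rewrite e wactE.
have E : scal (set_val y') (set_val s') = wact b t (scal (set_val y) (set_val s)).
  apply: (cell_map_inj hlam yD' lt1' (cell_disc_wact b t1 yD)).
    by rewrite wact_norm.
  by rewrite e (cell_map_wact k0 kn hlam hb).
have ss : set_val s = set_val s'.
  have : 1 - toC (set_val s') = 1 - toC (set_val s).
    by rewrite -N -N' E wact_norm.
  by move=> /(congr1 (fun a => 1 - a)); rewrite !subKr => /complex.complexI.
split; first exact: set_val_inj.
have [s11|s11] := eqVneq (set_val s : R) 1; [by left|right].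
apply/lens_projP; exists t => //.
have c0 : 1 - toC (set_val s) != 0.
  by rewrite subr_eq0 eq_sym -(rmorph1 toC) (inj_eq (@complex.complexI _)).
pose a := `|set_val y' : V| / `|set_val y : V|.
have a0 : 0 < a by rewrite divr_gt0.
have ya : set_val y' = a *: wact b t (set_val y).
  move: E; rewrite /scal -ss wactZ => /(congr1 (fun v : V => (`|set_val y' : V| / (1 - toC (set_val s))) *: v)).
  rewrite !scalerA; rewrite (_ : _ / _ * (_ / _) = 1); last first.
    by field; rewrite c0 (gt_eqF y0').
  by rewrite scale1r => ->; congr (_ *: _); rewrite /a; field; rewrite c0 (gt_eqF y0).
(* The sup norm determined the direction only up to a positive factor; both vectors have Euclidean
   norm 1, so the factor is 1. *)
suff a1 : a = 1 by rewrite ya a1 scale1r.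
have := yS'.2; rewrite ya; under eq_bigr do rewrite mxE normrM exprMn.
rewrite -mulr_sumr; have [_ ->] := GS (conj t0 tb) yS.
rewrite mulr1 gtr0_norm// => /eqP; rewrite sqrf_eq1 => /orP[/eqP//|/eqP aN].
by move: a0; rewrite aN oppr_gt0 ltr10.
Qed.

End CellAttachment.

Theorem proposition2p12 (R : realType) (k n m : nat)
    (hk : (1 <= k)%N) (hkn : (k < n)%N) (hm : m.+1 = 'C(n, k))
    (lam : 'I_m.+1 -> schubert k n) (hlam : schubert_order lam)
    (b : 'I_m.+1 -> nat) (hb : plucker_weight lam b)
    (i : nat) (hi : (1 <= i <= m)%N) :
  exists f : lens R lam b (inord (m - i)) ->
             set_type (skeleton R lam b i.-1),
    continuous f /\
    exists h : mapping_cone R f -> set_type (skeleton R lam b i),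
      homeomorphism h /\
      forall x, set_val (h (cone_base R f x)) = set_val x.
Proof.
have /andP[i1 im] := hi; set p : 'I_m.+1 := inord (m - i).
have pE : p = (m - i)%N :> nat by rewrite inordK// ltnS leq_subr.
have pm : (p < m)%N by rewrite pE ltn_subrL i1 (leq_trans i1).
have mp : (m - p)%N = i by rewrite pE subKn.
pose S := raised_sphere R lam p : set 'rV[Cplx R]_m.+1.
pose proj := @quot_proj _ (@orbit_rel R m b [set t : Cplx R | t != 0 /\ t ^+ b p = 1] S).
pose I01 := set_type `[0%R, 1%R : R]%classic.
pose cyl := @cyl_Gr R k n m lam hk hlam b p : set_type S * I01 -> Gr R lam b.
have cylS ys : skeleton R lam b i (cyl ys) by rewrite -mp; exact: cyl_Gr_skeleton.
(* A mere set-theoretic section. Continuity of [F] comes from the openness of the projection, and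
   independence of the section from [cyl_Gr_orbit]. *)
have /choice[sg sgE] (q : lens R lam b p) : exists y, proj y = q.
  exact: quot_proj_surj.
pose F (qs : lens R lam b p * I01) : set_type (skeleton R lam b i) :=
  set_elt (cylS (sg qs.1, qs.2)).
have FE y s : set_val (F (proj y, s)) = cyl (y, s).
  by apply: (cyl_Gr_orbit hk hkn hlam hb); exact: sgE.
have Fc : continuous F.
  apply: (@continuous_quot_prod _ _ _ _ proj).
  - exact: quot_proj_surj.
  - exact: (lens_proj_open hb).
  - apply: continuous_set_type.
    suff -> : (fun ys : set_type S * I01 => set_val (F (proj ys.1, ys.2))) = cyl.
      exact: cyl_Gr_continuous.
    by apply/funext => -[y s]; rewrite FE.
have I0 : `[0%R, 1%R : R]%classic 0 by rewrite /= in_itv /= ler01 lexx.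
pose z0 : I01 := set_elt I0.
have fS q : skeleton R lam b i.-1 (set_val (F (q, z0))).
  by rewrite -[in X in skeleton _ _ _ X]mp; exact: cyl_Gr_boundary.
pose f q : set_type (skeleton R lam b i.-1) := set_elt (fS q).
have fc : continuous f.
  apply: continuous_set_type => q.
  have cz : (fun=> z0) @ nbhs q --> z0 by exact: cvg_cst.
  have c1 : (q', z0) @[q' --> q] --> (q, z0) by exact: (cvg_pair (@cvg_id _ (nbhs q)) cz).
  exact: (cvg_comp _ _ (cvg_comp _ _ c1 (Fc (q, z0))) (@set_val_continuous _ _ (F (q, z0)))).
exists f; split=> //.
have sub (x : set_type (skeleton R lam b i.-1)) : skeleton R lam b i (set_val x).
  have [j jx xE] := set_val_in x; exists j => //=.
  by apply: leq_trans jx; rewrite leq_sub2l// leq_pred.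
pose f0 x : set_type (skeleton R lam b i) := set_elt (sub x).
have f0c : continuous f0 by apply: continuous_set_type; exact: set_val_continuous.
have F0 y s : set_val s = 0 -> F (y, s) = f0 (f y).
  move=> s0; apply: set_val_inj; rewrite (_ : s = z0)//; exact: set_val_inj.
have F1 y y' s s' : set_val s = 1 -> set_val s' = 1 -> F (y, s) = F (y', s').
  move=> s1 s1'; apply: set_val_inj; rewrite -(sgE y) -(sgE y') !FE.
  apply/cyl_GrP; exists 1; first exact: oner_neq0.
  by rewrite wact1 /scal s1 s1' rmorph1 subrr !mul0r !scale0r.
have [h hc [h0 hF]] := mapping_cone_lift f0c Fc F0 F1.
(* Cylinder points at height 0 are absorbed into the base, so injectivity need only treat heights
   [s > 0], which lie over the open cell. *)
have normal u : (exists x, u = cone_base R f x) \/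
    exists y s, u = quot_proj (cone_rel f) (cyl_pt _ (proj y) s) /\ 0 < (set_val s : R).
  have [[[|] v] <-] := quot_proj_surj u; last by left; exists v.
  case: v => q s; have [y yq] := quot_proj_surj q; rewrite -yq.
  have /andP[s0 _] := I01P s; have [s0'|s0'] := eqVneq (set_val s : R) 0.
    left; exists (f (proj y)); apply: quot_proj_eq; exact: cone_glue.
  by right; exists y, s; split; rewrite // lt_neqAle eq_sym s0'.
exists h; split; last by move=> x; rewrite h0.
apply: compact_hausdorff_homeomorphism => //.
- apply: mapping_cone_compact.
    by apply: quot_space_compact; apply: compact_set_type; exact: raised_sphere_compact.
  by apply: compact_set_type; exact: skeleton_compact.
- apply: (@hausdorff_inj _ _ set_val); first exact: set_val_continuous.
    by move=> x y; exact: set_val_inj.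
  exact: (Gr_hausdorff hk hkn hlam hb).
(* The [p]-th coordinate tells the two kinds of points apart: zero on the smaller skeleton, nonzero
   over the open cell. *)
- have base_cyl x y s : 0 < (set_val s : R) ->
      h (cone_base R f x) <> h (quot_proj (cone_rel f) (cyl_pt _ (proj y) s)).
    move=> s0; rewrite h0 hF => e0.
    have e1 : set_val x = cyl (y, s) by rewrite -FE -e0.
    have [x' x'E] := Gr_proj_surj (set_val x).
    have e : Gr_proj lam b x' = cyl (y, s) by rewrite x'E.
    have /eqP := cyl_Gr_inner s0 e; apply.
    have := set_val_in x; rewrite -x'E => /skeletonP; apply.
    by rewrite -mp -subnS subKn.
  move=> u v; have [[x ->]|[y [s [-> s0]]]] := normal u;
    have [[x' ->]|[y' [s' [-> s0']]]] := normal v.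
  + rewrite !h0 => /(congr1 set_val) /= e; congr (cone_base _ _ _).
    exact: set_val_inj.
  + by move/base_cyl.
  + by move/esym/base_cyl.
  + rewrite !hF => /(congr1 set_val); rewrite !FE => /(cyl_Gr_inj hkn hb s0 s0').
    move=> [<- [s1|pe]]; first by apply: quot_proj_eq; exact: cone_tip.
    by have -> : proj y = proj y' by exact: pe.
- move=> z; have [x xz] := Gr_proj_surj (set_val z).
  have xlt (j : 'I_m.+1) : (j < p)%N -> set_val x 0 j = 0.
    have := set_val_in z; rewrite -xz => /skeletonP/(_ j).
    by rewrite -[in X in (_ < X)%N -> _]mp subKn// ltnW.
  have [xp|xp] := eqVneq (set_val x 0 p) 0.
    have xS : skeleton R lam b i.-1 (set_val z).
      rewrite -xz; apply/skeletonP => j; rewrite -mp -subnS subKn// ltnS.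
      by rewrite leq_eqVlt => /orP[/eqP/val_inj ->|/xlt].
    by exists (cone_base R f (set_elt xS)); rewrite h0; exact: set_val_inj.
  have [[y s] ys] := cyl_Gr_cover hk hkn hlam hb pm xlt xp.
  exists (quot_proj (cone_rel f) (cyl_pt _ (proj y) s)).
  by rewrite hF; apply: set_val_inj; rewrite FE -xz.
Qed.
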